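(* Let $1\le\nu<\infty$, let $\phi(z)=az+b$ with $0<|a|<1$, $b\in\mathbb{C}$, and let $w(z)=e^{p+qz+rz^2}$ with $p,q,r\in\mathbb{C}$ and $0<|r|\le(1-|a|^2)/2$, and assume $W_{w,\phi}$ is bounded on $\mathcal{F}^\nu$. Then: if $\operatorname{Re}p+\operatorname{Re}\left(\frac{qb}{1-a}\right)+\operatorname{Re}\left(\frac{rb^2}{(1-a)^2}\right)>0$, the operator $W_{w,\phi}$ is not power-bounded on $\mathcal{F}^\nu$; if $\operatorname{Re}p+\operatorname{Re}\left(\frac{qb}{1-a}\right)+\operatorname{Re}\left(\frac{rb^2}{(1-a)^2}\right)-\ln|a|<0$, the operator $W_{w,\phi}$ is power-bounded on $\mathcal{F}^\nu$.
   Context: For $1\le\nu<\infty$, $\mathcal{F}^\nu$ is the space of entire functions $f$ with $\|f\|_\nu:=\left(\frac{\nu}{2\pi}\int_{\mathbb{C}}|f(z)|^\nu e^{-\nu|z|^2/2}\,dm(z)\right)^{1/\nu}<\infty$. $W_{w,\phi}f=w\,(f\circ\phi)$. An operator $T$ is power-bounded if $\sup_{n\ge1}\|T^n\|<\infty$. *)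

(* Defs.v *)
From HB Require Import structures.
From mathcomp Require Import all_boot all_order all_algebra.
From mathcomp Require Import all_classical all_reals all_analysis.
From mathcomp Require Import complex.
Import Order.TTheory GRing.Theory Num.Theory.
Import numFieldNormedType.Exports.

Set Implicit Arguments.
Unset Strict Implicit.
Unset Printing Implicit Defensive.

Local Open Scope ring_scope.
Local Open Scope complex_scope.

Section Fock.
Variable R : realType.

Definition cabs (z : R[i]) : R :=
  Num.sqrt (complex.Re z ^+ 2 + complex.Im z ^+ 2).

Definition cexp (u : R[i]) : R[i] :=
  (expR (complex.Re u) * cos (complex.Im u)) +i*
  (expR (complex.Re u) * sin (complex.Im u)).

(* f is entire: complex differentiable at every point of C
   (derivative in the sense of the normed C-module C over itself) *)
Definition entire (f : R[i] -> R[i]) : Prop :=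
  forall z : R[i], derivable (f : R[i]^o -> R[i]^o) z 1.

Definition fock_integral (nu : R) (f : R[i] -> R[i]) : \bar R :=
  (\int[(@lebesgue_measure R) \x lebesgue_measure]_xy
     ((cabs (f (xy.1 +i* xy.2))) `^ nu *
        expR (- (nu * cabs (xy.1 +i* xy.2) ^+ 2) / 2))%:E)%E.

Definition in_fock (nu : R) (f : R[i] -> R[i]) : Prop :=
  entire f /\ (fock_integral nu f < +oo)%E.

Definition fock_norm (nu : R) (f : R[i] -> R[i]) : R :=
  (nu / (2 * pi) * fine (fock_integral nu f)) `^ (nu^-1).

Definition wcomp (w phi : R[i] -> R[i]) (f : R[i] -> R[i]) : R[i] -> R[i] :=
  fun z => w z * f (phi z).

Definition bounded_on_fock (nu : R) (T : (R[i] -> R[i]) -> (R[i] -> R[i])) : Prop :=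
  (forall f, in_fock nu f -> in_fock nu (T f)) /\
  exists K : R, forall f, in_fock nu f -> fock_norm nu (T f) <= K * fock_norm nu f.

Definition power_bounded_on_fock (nu : R)
    (T : (R[i] -> R[i]) -> (R[i] -> R[i])) : Prop :=
  exists M : R, forall n : nat, (0 < n)%N -> forall f, in_fock nu f ->
    in_fock nu (iter n T f) /\
    fock_norm nu (iter n T f) <= M * fock_norm nu f.

End Fock.

(* Main.v *)
(** The point z0 = b/(1-a) is fixed by phi. With the weight G_f(z) = |f(z)| exp(-|z|^2/2),
    the n-th iterate satisfies
      G_{W^n f}(z0+h) = exp(n c + sum_{j<n} S(a^j h)) G_f(z0 + a^n h),
    where c is the real number of the statement and S is a real polynomial of degree two
    without constant term.

    If c > 0, the factor exp(n c) makes the norms of W^n 1 explode, since the sums of S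
    stay bounded on a unit box at z0.

    If c < ln|a|, testing W on the exponential kernels shows that S is bounded above, and
    then sum_{j<n} S(a^j h) <= C - eta(h)^2 uniformly in n >= 1, for a nonzero real linear
    form eta.  By Cauchy's formula, G_f(u)^nu is dominated by a Gaussian mean of G_f^nu
    around u; integrating the two Gaussians against each other (Tonelli) costs only one
    factor 1/|a|^n, because eta confines h in one direction.  Hence the nu-th power of the
    norm of W^n is at most a constant times (exp(nu c)/|a|)^n, which is at most 1 as nu >= 1.

    Cauchy's theorem for functions that are merely complex differentiable is obtained by
    bisection of rectangles (Goursat). *)
Require Import Defs.
From HB Require Import structures.
From mathcomp Require Import all_boot all_order all_algebra.
From mathcomp Require Import all_classical all_reals all_analysis.
From mathcomp Require Import complex ring lra measurable_realfun.
Import Order.TTheory GRing.Theory Num.Theory.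
Import numFieldNormedType.Exports.

Set Implicit Arguments.
Unset Strict Implicit.
Unset Printing Implicit Defensive.

Local Open Scope ring_scope.
Local Open Scope complex_scope.
Local Open Scope classical_set_scope.
Local Notation Re := complex.Re.
Local Notation Im := complex.Im.

(** The obstacle is the exponent of |a|. Once the sums of S are bounded above, the change of
    variables h -> a^n h alone costs |a|^(-2n) and would need nu c <= 2 ln|a|, which c < ln|a| does
    not give when nu < 2. One factor has to be saved, and this is where r != 0 enters: Re(r h^2) =
    |r||h|^2 - 2 eta(h)^2 with eta(h) = Im(sqrt(r) h), so under |r| <= (1-|a|^2)/2 the quadratic
    part of S is at most -2 eta^2. Decay across the line eta = 0 does not help by itself, because
    G_f could concentrate on a thin strip along it; smearing G_f^nu at unit scale by the
    sub-mean-value inequality excludes this. The delicate case is |r| = (1-|a|^2)/2, where the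
    quadratic part vanishes on that line: the boundedness of S then has to control its linear part
    too. Only uniformity in n matters, never the size of constants. Cauchy's formula is therefore
    used in a crude form: real circulations of Im(g dz) around rectangles, then a choice of four
    good sides instead of polar coordinates. *)

Section Bisection.
Variable R : realType.
Implicit Types x y : R.

Record rect := Rect { rl : R ; rr : R ; rb : R ; rt : R }.

Definition subrect (q q' : rect) := [/\ rl q' <= rl q, rl q <= rr q, rr q <= rr q' &
  [/\ rb q' <= rb q, rb q <= rt q & rt q <= rt q']].

Definition in_rect (q : rect) x y := rl q <= x <= rr q /\ rb q <= y <= rt q.

Lemma subrect_trans q1 q2 q3 : subrect q1 q2 -> subrect q2 q3 -> subrect q1 q3.
Proof.
move=> [a1 a2 a3 [a4 a5 a6]] [b1 b2 b3 [b4 b5 b6]].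
by split; [lra|lra|lra|split; lra].
Qed.

Variables (F : rect -> R) (q0 : rect).
Hypothesis q0_ok : subrect q0 q0.
Hypothesis F_vsplit : forall a b c y y', subrect (Rect a c y y') q0 -> a <= b <= c ->
  F (Rect a c y y') = F (Rect a b y y') + F (Rect b c y y').
Hypothesis F_hsplit : forall x x' a b c, subrect (Rect x x' a c) q0 -> a <= b <= c ->
  F (Rect x x' a c) = F (Rect x x' a b) + F (Rect x x' b c).
Hypothesis F_local : forall x y, in_rect q0 x y -> forall e, 0 < e -> exists2 d, 0 < d &
  forall q, subrect q q0 -> in_rect q x y -> rr q - rl q < d -> rt q - rb q < d ->
  `|F q| <= e * ((rr q - rl q) + (rt q - rb q)) ^+ 2.

(** Keeps a quarter that carries at least a fourth of |F q|. The last one is returned untested: when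
    the other three fail, additivity and the triangle inequality force it ([quarter_ge]). *)
Let quarter (q : rect) : rect :=
  let xm := (rl q + rr q) / 2 in let ym := (rb q + rt q) / 2 in
  let q1 := Rect (rl q) xm (rb q) ym in let q2 := Rect xm (rr q) (rb q) ym in
  let q3 := Rect (rl q) xm ym (rt q) in let q4 := Rect xm (rr q) ym (rt q) in
  if `|F q| / 4 <= `|F q1| then q1 else if `|F q| / 4 <= `|F q2| then q2
  else if `|F q| / 4 <= `|F q3| then q3 else q4.

Let quarter_size q : rr (quarter q) - rl (quarter q) = (rr q - rl q) / 2 /\
  rt (quarter q) - rb (quarter q) = (rt q - rb q) / 2.
Proof.
by rewrite /quarter; case: ifP => _; [|case: ifP => _; [|case: ifP => _]]; split=> /=; lra.
Qed.

Let quarter_sub q : subrect q q0 -> subrect (quarter q) q.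
Proof.
move=> [h1 h2 h3 [h4 h5 h6]].
by rewrite /quarter; case: ifP => _; [|case: ifP => _; [|case: ifP => _]];
  split=> /=; try lra; split; lra.
Qed.

Let quarter_ge q : subrect q q0 -> `|F q| / 4 <= `|F (quarter q)|.
Proof.
case: q => a c y y' qs; have [/= h1 h2 h3 [h4 h5 h6]] := qs.
have xm : a <= (a + c) / 2 <= c by apply/andP; split; lra.
have ym : y <= (y + y') / 2 <= y' by apply/andP; split; lra.
have E : F (Rect a c y y') =
    (F (Rect a ((a + c) / 2) y ((y + y') / 2)) +
     F (Rect ((a + c) / 2) c y ((y + y') / 2))) +
    (F (Rect a ((a + c) / 2) ((y + y') / 2) y') +
     F (Rect ((a + c) / 2) c ((y + y') / 2) y')).
  rewrite (F_hsplit qs ym) (F_vsplit _ xm); last by split=> /=; try lra; split; lra.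
  by congr (_ + _); rewrite (F_vsplit _ xm) //; split=> /=; try lra; split; lra.
rewrite /quarter /=; case: ifPn => //; rewrite -ltNge => n1.
case: ifPn => //; rewrite -ltNge => n2.
case: ifPn => //; rewrite -ltNge => n3.
have := ler_normD (F (Rect a ((a + c) / 2) y ((y + y') / 2)) +
     F (Rect ((a + c) / 2) c y ((y + y') / 2))) (F (Rect a ((a + c) / 2) ((y + y') / 2) y') +
     F (Rect ((a + c) / 2) c ((y + y') / 2) y')); rewrite -E.
have := ler_normD (F (Rect a ((a + c) / 2) y ((y + y') / 2)))
     (F (Rect ((a + c) / 2) c y ((y + y') / 2))).
have := ler_normD (F (Rect a ((a + c) / 2) ((y + y') / 2) y'))
     (F (Rect ((a + c) / 2) c ((y + y') / 2) y')).
lra.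
Qed.

Let seqr n := iter n quarter q0.

Let seqr_sub n : subrect (seqr n) q0.
Proof.
elim: n => [|n IH] //=; exact: subrect_trans (quarter_sub IH) IH.
Qed.

Let seqr_mono m n : (m <= n)%N -> subrect (seqr n) (seqr m).
Proof.
move=> /subnK <-; elim: (n - m)%N => [|k IH]; rewrite ?add0n.
  by have [h1 h2 h3 [h4 h5 h6]] := seqr_sub m; split => //; split.
rewrite addSn; exact: subrect_trans (quarter_sub (seqr_sub _)) IH.
Qed.

Let seqr_size n : rr (seqr n) - rl (seqr n) = (rr q0 - rl q0) / 2 ^+ n /\
  rt (seqr n) - rb (seqr n) = (rt q0 - rb q0) / 2 ^+ n.
Proof.
elim: n => [|n [IH1 IH2]]; first by rewrite expr0 !divr1.
have [-> ->] := quarter_size (seqr n).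
by rewrite IH1 IH2 exprS; split; field; rewrite expf_neq0.
Qed.

Let seqr_ge n : `|F q0| / 4 ^+ n <= `|F (seqr n)|.
Proof.
elim: n => [|n IH]; first by rewrite expr0 divr1.
apply: le_trans (quarter_ge (seqr_sub n)).
by rewrite exprS invfM mulrCA mulrC ler_pM2r// invr_gt0.
Qed.

Let nested (l u : nat -> R) : (forall n, l n <= u n) ->
  (forall m n, (m <= n)%N -> l m <= l n /\ u n <= u m) -> exists x, forall n, l n <= x <= u n.
Proof.
move=> lu mono; exists (sup (range l)) => n.
have ub m : ubound (range l) (u m).
  move=> _ [k _ <-]; have [mk|/ltnW km] := leqP m k.
    by have [_] := mono _ _ mk; apply: le_trans.
  by have [+ _] := mono _ _ km; move=> /le_trans; apply.
apply/andP; split.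
  apply: ub_le_sup; last by exists n.
  by exists (u 0%N); exact: ub.
by apply: ge_sup; [exists (l 0%N), 0%N|exact: ub].
Qed.

(** After n bisections |F| has lost at most a factor 4^n, while the square of the side sum has lost
    exactly 4^n. The local bound at the common point of the nested rectangles thus transfers back to
    [q0] with the same e. *)
Lemma bisection_zero : F q0 = 0.
Proof.
have [x xP] : exists x, forall n, rl (seqr n) <= x <= rr (seqr n).
  apply: nested => [n|m n mn]; first by case: (seqr_sub n).
  by case: (seqr_mono mn) => ? ? ? _; split.
have [y yP] : exists y, forall n, rb (seqr n) <= y <= rt (seqr n).
  apply: nested => [n|m n mn]; first by case: (seqr_sub n) => _ _ _ [].
  by case: (seqr_mono mn) => ? ? ? [].
apply/eqP; rewrite -normr_le0; apply/ler_addgt0Pr => e e0; rewrite add0r.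
set w := rr q0 - rl q0; set h := rt q0 - rb q0.
have w0 : 0 <= w by rewrite subr_ge0; case: q0_ok.
have h0 : 0 <= h by rewrite subr_ge0; case: q0_ok => _ _ _ [].
have wh : 0 < 1 + (w + h) ^+ 2 by rewrite ltr_pwDl// sqr_ge0.
(* Dividing by 1 + (w + h)^2 makes the final bound at most e; the summand 1 covers the case where
   [q0] is a point. *)
have [d d0 dP] := F_local (conj (xP 0%N) (yP 0%N)) (divr_gt0 e0 wh).
have [n nP] : exists n, (w + h) / 2 ^+ n < d.
  exists (Num.bound ((w + h) / d)); set n := Num.bound _.
  have p2 : 0 < 2 ^+ n :> R by rewrite exprn_gt0.
  rewrite ltr_pdivrMr// mulrC -ltr_pdivrMr//.
  exact: (upper_nthrootP (leqnn _)).
have [sw sh] := seqr_size n.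
have p2 : 0 < 2 ^+ n :> R by rewrite exprn_gt0.
have := dP (seqr n) (seqr_sub n) (conj (xP n) (yP n)).
rewrite sw sh -/w -/h => /(_ _ _)/(le_trans (seqr_ge n)).
have -> : 4 ^+ n = 2 ^+ n * 2 ^+ n :> R by rewrite -exprMn; congr (_ ^+ _); rewrite -natrM.
move=> H.
have {}H : `|F q0| <= e / (1 + (w + h) ^+ 2) * (w + h) ^+ 2.
  rewrite -(ler_pM2r (_ : 0 < (2 ^+ n * 2 ^+ n)^-1)) ?invr_gt0 ?mulr_gt0//.
  apply: le_trans (H _ _) _.
  - by apply: le_lt_trans nP; rewrite ler_pM2r ?invr_gt0// lerDl.
  - by apply: le_lt_trans nP; rewrite ler_pM2r ?invr_gt0// lerDr.
  rewrite le_eqVlt; apply/orP; left; apply/eqP; field; rewrite !gt_eqF//.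
apply: le_trans H _; rewrite mulrAC ler_pdivrMr// ler_pM2l// lerDr//.
Qed.

End Bisection.

(** * Goursat's theorem on rectangles *)

Section SegmentIntegral.
Variable R : realType.
Implicit Types (f g : R -> R) (a b c k e : R).

Local Notation mu := (@lebesgue_measure R).

(** Continuity is two-sided even at the endpoints: differentiability at the points of the segment
    provides it directly, and it restricts to subsegments. *)
Definition cont_seg f a b := forall x, a <= x <= b -> {for x, continuous f}.

Definition Iseg f a b : R := \int[mu]_(x in `[a, b]) f x.

Lemma cont_seg_integrable f a b : cont_seg f a b -> mu.-integrable `[a, b] (EFin \o f).
Proof.
move=> cf; apply: continuous_compact_integrable; first exact: segment_compact.
apply: continuous_in_subspaceT => x; rewrite inE /= in_itv /=; exact: cf.
Qed.

Lemma Iseg_split f a b c : cont_seg f a c -> a <= b <= c -> Iseg f a c = Iseg f a b + Iseg f b c.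
Proof.
move=> cf /andP[ab bc].
have i1 := cont_seg_integrable cf.
have bcf : cont_seg f b c.
  by move=> x /andP[bx xc]; apply: cf; rewrite (le_trans ab).
have := @Rintegral_itvB R f (BLeft a) (BRight c) b i1.
rewrite !bnd_simp => /(_ ab bc) /eqP; rewrite subr_eq => /eqP; rewrite /Iseg => ->.
rewrite addrC; congr (_ + _); rewrite Rintegral_itv_obnd_cbnd//.
by apply: (integrableS _ _ _ (cont_seg_integrable bcf)) => //; exact: subset_itv_oc_cc.
Qed.

Lemma Iseg_cst k a b : a <= b -> Iseg (fun=> k) a b = k * (b - a).
Proof.
move=> ab; rewrite /Iseg Rintegral_cst//= lebesgue_measure_itv /= lte_fin.
by case: ltP => // ba; have -> : a = b by [lra]; rewrite subrr.
Qed.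

Lemma cont_seg_cst k a b : cont_seg (fun=> k) a b.
Proof. by move=> x _; exact: cvg_cst. Qed.

Lemma Iseg_le f g a b : cont_seg f a b -> cont_seg g a b ->
  (forall x, a <= x <= b -> f x <= g x) -> Iseg f a b <= Iseg g a b.
Proof.
move=> cf cg fg; by apply: le_Rintegral => //; exact: cont_seg_integrable.
Qed.

Lemma Iseg_near f k e a b : a <= b -> cont_seg f a b ->
  (forall x, a <= x <= b -> `|f x - k| <= e) -> `|Iseg f a b - k * (b - a)| <= e * (b - a).
Proof.
move=> ab cf fk; rewrite ler_distl -mulrBl -mulrDl -!Iseg_cst//.
by apply/andP; split; apply: Iseg_le => // [|x /fk]; do ?exact: cont_seg_cst;
  rewrite ler_distl => /andP[].
Qed.

Lemma IsegD f g a b : cont_seg f a b -> cont_seg g a b ->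
  Iseg (fun x => f x + g x) a b = Iseg f a b + Iseg g a b.
Proof. by move=> cf cg; rewrite /Iseg RintegralD//; exact: cont_seg_integrable. Qed.

Lemma cont_segD f g a b : cont_seg f a b -> cont_seg g a b -> cont_seg (fun x => f x + g x) a b.
Proof. by move=> cf cg x xab; apply: continuousD; [exact: cf|exact: cg]. Qed.

Lemma cont_segN f a b : cont_seg f a b -> cont_seg (fun x => - f x) a b.
Proof. by move=> cf x xab; apply: continuousN; exact: cf. Qed.

Lemma cont_segB f g a b : cont_seg f a b -> cont_seg g a b -> cont_seg (fun x => f x - g x) a b.
Proof. by move=> cf cg; apply: cont_segD => //; exact: cont_segN. Qed.

Lemma lipschitz_at_continuous f x K d : 0 < d ->
  (forall x', `|x' - x| < d -> `|f x' - f x| <= K * `|x' - x|) -> {for x, continuous f}.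
Proof.
move=> d0 H; apply/cvgrPdist_lt => e e0.
have K1 : 0 < `|K| + 1 by rewrite ltr_pwDr.
have nb r : 0 < r -> \forall t \near x, `|x - t| < r.
  by move=> r0; apply/nbhs_ballP; exists r.
near=> t.
have td : `|t - x| < d.
  by rewrite distrC; near: t; exact: nb.
rewrite distrC (le_lt_trans (H _ td))//.
apply: (@le_lt_trans _ _ ((`|K| + 1) * `|t - x|)).
  by rewrite ler_wpM2r// (le_trans (ler_norm _))// lerDl.
rewrite mulrC -ltr_pdivlMr//.
rewrite distrC; near: t; apply: nb; exact: divr_gt0.
Unshelve. all: end_near. Qed.

End SegmentIntegral.

Section Goursat.
Variable R : realType.
Variables P Q : R -> R -> R.

(* Differentiability of the form P dx + Q dy at a point, with d_y P = d_x Q there. *)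
Definition closed_at (x0 y0 : R) := exists A B D : R, forall e, 0 < e -> exists2 d, 0 < d &
  forall x y, `|x - x0| < d -> `|y - y0| < d ->
    `|P x y - P x0 y0 - (A * (x - x0) + B * (y - y0))| <= e * (`|x - x0| + `|y - y0|) /\
    `|Q x y - Q x0 y0 - (B * (x - x0) + D * (y - y0))| <= e * (`|x - x0| + `|y - y0|).

Lemma closed_at_continuous x y : closed_at x y ->
  [/\ {for x, continuous (P ^~ y)}, {for y, continuous (P x)},
      {for x, continuous (Q ^~ y)} & {for y, continuous (Q x)}].
Proof.
move=> [A [B [D /(_ _ ltr01)[d d0 H]]]].
have tri (u v w : R) (k : R) : `|u - k * v| <= 1 * `|v| -> `|u| <= (`|k| + 1) * `|v|.
  move=> uk; rewrite -[u](subrK (k * v)) (le_trans (ler_normD _ _))//.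
  by rewrite normrM mulrDl addrC lerD.
split; [apply: (@lipschitz_at_continuous _ _ _ (`|A| + 1) d)|
  apply: (@lipschitz_at_continuous _ _ _ (`|B| + 1) d)|
  apply: (@lipschitz_at_continuous _ _ _ (`|B| + 1) d)|
  apply: (@lipschitz_at_continuous _ _ _ (`|D| + 1) d)] => // z zd; apply: tri => //.
- by have [+ _] := H z y zd ltac:(by rewrite subrr normr0); rewrite !subrr normr0 mulr0 !addr0.
- by have [+ _] := H x z ltac:(by rewrite subrr normr0) zd; rewrite !subrr normr0 mulr0 !add0r.
- by have [_ +] := H z y zd ltac:(by rewrite subrr normr0); rewrite !subrr normr0 mulr0 !addr0.
- by have [_ +] := H x z ltac:(by rewrite subrr normr0) zd; rewrite !subrr normr0 mulr0 !add0r.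
Qed.

(* The circulation of P dx + Q dy around the boundary; pairing opposite sides
   makes the contribution of an exact affine part vanish under the integrals. *)
Definition circ (q : rect R) : R :=
  Iseg (fun x => P x (rb q) - P x (rt q)) (rl q) (rr q) +
  Iseg (fun y => Q (rr q) y - Q (rl q) y) (rb q) (rt q).

Lemma circ_vsplit a b c y y' : a <= b <= c ->
  cont_seg (P ^~ y) a c -> cont_seg (P ^~ y') a c ->
  (forall x, x \in [:: a; b; c] -> cont_seg (Q x) y y') ->
  circ (Rect a c y y') = circ (Rect a b y y') + circ (Rect b c y y').
Proof.
move=> abc cy cy' cQ.
rewrite /circ /= (Iseg_split _ abc); last exact: cont_segB.
rewrite [RHS]addrACA; congr (_ + _); rewrite -IsegD.
- by congr (Iseg _ _ _); apply/funext => z; ring.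
- by apply: cont_segB; apply: cQ; rewrite !inE eqxx ?orbT.
- by apply: cont_segB; apply: cQ; rewrite !inE eqxx ?orbT.
Qed.

Lemma circ_hsplit x x' a b c : a <= b <= c ->
  cont_seg (Q x) a c -> cont_seg (Q x') a c ->
  (forall y, y \in [:: a; b; c] -> cont_seg (P ^~ y) x x') ->
  circ (Rect x x' a c) = circ (Rect x x' a b) + circ (Rect x x' b c).
Proof.
move=> abc cx cx' cP.
rewrite /circ /= (Iseg_split _ abc); last exact: cont_segB.
rewrite [RHS]addrACA; congr (_ + _); rewrite -IsegD.
- by congr (Iseg _ _ _); apply/funext => z; ring.
- by apply: cont_segB; apply: cP; rewrite !inE eqxx ?orbT.
- by apply: cont_segB; apply: cP; rewrite !inE eqxx ?orbT.
Qed.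

Variable q0 : rect R.
Hypothesis clo : forall x y, in_rect q0 x y -> closed_at x y.

Lemma closed_cont_x a b y : rl q0 <= a -> b <= rr q0 -> rb q0 <= y <= rt q0 ->
  cont_seg (P ^~ y) a b.
Proof.
move=> h1 h2 h3 x /andP[ax xb].
have /clo/closed_at_continuous[] // : in_rect q0 x y.
by split => //; apply/andP; split; lra.
Qed.

Lemma closed_cont_y a b x : rb q0 <= a -> b <= rt q0 -> rl q0 <= x <= rr q0 ->
  cont_seg (Q x) a b.
Proof.
move=> h1 h2 h3 y /andP[ax xb].
have /clo/closed_at_continuous[] // : in_rect q0 x y.
by split => //; apply/andP; split; lra.
Qed.

(** In the differences over opposite sides the constants and the coefficients [A] and [D] drop out.
    What remains is B(y1 - y2)(b - a) from P and B(b - a)(y2 - y1) from Q; they cancel because both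
    forms share the same [B]. Only the remainders survive. *)
Lemma circ_local x y : in_rect q0 x y -> forall e, 0 < e -> exists2 d, 0 < d &
  forall q, subrect q q0 -> in_rect q x y -> rr q - rl q < d -> rt q - rb q < d ->
  `|circ q| <= e * ((rr q - rl q) + (rt q - rb q)) ^+ 2.
Proof.
(* Half of e, since each integrand is a difference of two values with one remainder each. *)
move=> /clo[A [B [D H]]] e e0; have [d d0 {}H] := H (e / 2) (divr_gt0 e0 (ltr0n _ 2)).
exists d => // -[a b y1 y2] [/= h1 h2 h3 [h4 h5 h6]] [/= /andP[k1 k2] /andP[k3 k4]] l1 l2.
set s := (b - a) + (y2 - y1).
have dist u : a <= u <= b -> `|u - x| <= b - a.
  by move=> /andP[? ?]; rewrite ler_norml; apply/andP; split; lra.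
have dist' u : y1 <= u <= y2 -> `|u - y| <= y2 - y1.
  by move=> /andP[? ?]; rewrite ler_norml; apply/andP; split; lra.
have y1P : y1 <= y1 <= y2 by rewrite lexx.
have y2P : y1 <= y2 <= y2 by rewrite lexx h5.
have aP : a <= a <= b by rewrite lexx.
have bP : a <= b <= b by rewrite lexx h2.
have main u v : a <= u <= b -> y1 <= v <= y2 ->
    `|P u v - P x y - (A * (u - x) + B * (v - y))| <= e / 2 * s /\
    `|Q u v - Q x y - (B * (u - x) + D * (v - y))| <= e / 2 * s.
  move=> uP vP; have [HP HQ] := H u v (le_lt_trans (dist _ uP) l1) (le_lt_trans (dist' _ vP) l2).
  have ss : e / 2 * (`|u - x| + `|v - y|) <= e / 2 * s.
    by rewrite ler_pM2l ?divr_gt0// lerD ?dist ?dist'.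
  by split; [exact: le_trans HP ss|exact: le_trans HQ ss].
have I1 : `|Iseg (fun u => P u y1 - P u y2) a b - (B * (y1 - y2)) * (b - a)| <= e * s * (b - a).
  apply: Iseg_near => //.
    by apply: cont_segB; apply: closed_cont_x => //; apply/andP; split; lra.
  move=> u uP; have [m1 _] := main u _ uP y1P; have [m2 _] := main u _ uP y2P.
  move: m1 m2; rewrite !ler_norml => /andP[? ?] /andP[? ?]; apply/andP; split; lra.
have I2 : `|Iseg (fun v => Q b v - Q a v) y1 y2 - (B * (b - a)) * (y2 - y1)| <= e * s * (y2 - y1).
  apply: Iseg_near => //.
    by apply: cont_segB; apply: closed_cont_y => //; apply/andP; split; lra.
  move=> v vP; have [_ m1] := main _ v aP vP; have [_ m2] := main _ v bP vP.
  move: m1 m2; rewrite !ler_norml => /andP[? ?] /andP[? ?]; apply/andP; split; lra.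
rewrite /circ /= -/s.
have -> : e * s ^+ 2 = e * s * (b - a) + e * s * (y2 - y1) by rewrite /s; ring.
apply: le_trans (lerD I1 I2); apply: le_trans (ler_normD _ _).
by rewrite le_eqVlt; apply/orP; left; apply/eqP; congr (`|_|); ring.
Qed.

Theorem circ_closed : rl q0 <= rr q0 -> rb q0 <= rt q0 -> circ q0 = 0.
Proof.
move=> h1 h2; apply: (@bisection_zero _ circ q0).
- by split => //; split.
- move=> a b c y y' [/= k1 k2 k3 [k4 k5 k6]] abc; have /andP[ab bc] := abc.
  apply: circ_vsplit => //; do ?[by apply: closed_cont_x => //; apply/andP; split; lra].
  move=> x; rewrite !inE => /or3P[] /eqP ->; apply: closed_cont_y => //; apply/andP; split; lra.
- move=> x x' a b c [/= k1 k2 k3 [k4 k5 k6]] abc; have /andP[ab bc] := abc.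
  apply: circ_hsplit => //; do ?[by apply: closed_cont_y => //; apply/andP; split; lra].
  move=> y; rewrite !inE => /or3P[] /eqP ->; apply: closed_cont_x => //; apply/andP; split; lra.
- exact: circ_local.
Qed.

End Goursat.

(** * Complex modulus and complex differentiability *)

Section ComplexModulus.
Variable R : realType.
Implicit Types z w h u : R[i].

Lemma normC_cabs z : `|z| = (cabs z)%:C.
Proof. by rewrite normc_def. Qed.

Lemma cabsM z w : cabs (z * w) = cabs z * cabs w.
Proof. by apply: complexI; rewrite rmorphM /= -!normC_cabs normrM. Qed.

Lemma cabsV z : cabs z^-1 = (cabs z)^-1.
Proof. by apply: complexI; rewrite fmorphV /= -!normC_cabs normfV. Qed.

Lemma cabsX z n : cabs (z ^+ n) = cabs z ^+ n.
Proof. by apply: complexI; rewrite rmorphXn /= -!normC_cabs normrX. Qed.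

Lemma cabsN z : cabs (- z) = cabs z.
Proof. by apply: complexI; rewrite -!normC_cabs normrN. Qed.

Lemma ler_cabsD z w : cabs (z + w) <= cabs z + cabs w.
Proof. by rewrite -lecR rmorphD /= -!normC_cabs ler_normD. Qed.

Lemma cabs_ge0 z : 0 <= cabs z.
Proof. exact: sqrtr_ge0. Qed.

Lemma cabs0 : cabs (0 : R[i]) = 0.
Proof. by apply: complexI; rewrite -normC_cabs normr0. Qed.

Lemma cabs1 : cabs (1 : R[i]) = 1.
Proof. by apply: complexI; rewrite -normC_cabs normr1. Qed.

Lemma cabs_eq0 z : (cabs z == 0) = (z == 0).
Proof. by rewrite -(inj_eq (@complexI R)) -normC_cabs normr_eq0. Qed.

Lemma cabs_gt0 z : (0 < cabs z) = (z != 0).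
Proof. by rewrite lt_neqAle cabs_ge0 andbT eq_sym cabs_eq0. Qed.

Lemma sqr_cabs z : cabs z ^+ 2 = Re z ^+ 2 + Im z ^+ 2.
Proof. by rewrite sqr_sqrtr// addr_ge0 ?sqr_ge0. Qed.

Lemma normr_Re_le z : `|Re z| <= cabs z.
Proof. by rewrite -sqrtr_sqr ler_wsqrtr// lerDl sqr_ge0. Qed.

Lemma normr_Im_le z : `|Im z| <= cabs z.
Proof. by rewrite -sqrtr_sqr ler_wsqrtr// lerDr sqr_ge0. Qed.

Lemma cabs_le_ReIm z : cabs z <= `|Re z| + `|Im z|.
Proof.
rewrite -[leRHS]ger0_norm ?addr_ge0// -sqrtr_sqr ler_wsqrtr//.
have := mulr_ge0 (normr_ge0 (Re z)) (normr_ge0 (Im z)).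
have := real_normK (num_real (Re z)); have := real_normK (num_real (Im z)).
rewrite sqrrD; lra.
Qed.

Lemma ReD z w : Re (z + w) = Re z + Re w. Proof. by case: z w => ? ? []. Qed.
Lemma ImD z w : Im (z + w) = Im z + Im w. Proof. by case: z w => ? ? []. Qed.
Lemma ReN z : Re (- z) = - Re z. Proof. by case: z. Qed.
Lemma ImN z : Im (- z) = - Im z. Proof. by case: z. Qed.
Lemma ReM z w : Re (z * w) = Re z * Re w - Im z * Im w. Proof. by case: z w => ? ? []. Qed.
Lemma ImM z w : Im (z * w) = Re z * Im w + Im z * Re w. Proof. by case: z w => ? ? []. Qed.
Lemma ReC (x : R) : Re x%:C = x. Proof. by []. Qed.
Lemma ImC (x : R) : Im x%:C = 0. Proof. by []. Qed.
Definition ReImE := (ReD, ImD, ReN, ImN, ReM, ImM, ReC, ImC).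

Lemma complex_ext z w : Re z = Re w -> Im z = Im w -> z = w.
Proof. by case: z w => ? ? [? ?] /= -> ->. Qed.

End ComplexModulus.

Section ComplexDerivative.
Variable R : realType.
Implicit Types f g : R[i] -> R[i].

(** Complex differentiability with real epsilons and [cabs], the form used in all estimates; the
    next two lemmas show that it is equivalent to the [derivable] of [entire]. *)
Definition cdiff f (z : R[i]) := exists d : R[i], forall e : R, 0 < e -> exists2 r : R, 0 < r &
  forall h, cabs h < r -> cabs (f (z + h) - f z - d * h) <= e * cabs h.

Lemma derivable_cdiff f z : derivable (f : R[i]^o -> R[i]^o) z 1 -> cdiff f z.
Proof.
move=> /cvg_ex[d /cvgrPdist_le H]; exists d => e e0.
have e0' : 0 < e%:C :> R[i] by rewrite ltcR.
have [r /= r0 rP] := H _ e0'.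
have rR : r = (Re r)%:C by rewrite RRe_real// gtr0_real.
exists (Re r); first by move: r0; rewrite rR ltcR.
move=> h hr; have [->|h0] := eqVneq h 0.
  by rewrite addr0 subrr mulr0 subrr cabs0 mulr0.
have := rP h; rewrite /ball_ /= sub0r normrN normC_cabs rR ltcR => /(_ hr h0).
rewrite normC_cabs lecR => {}rP.
rewrite -ler_pdivrMr ?cabs_gt0// -cabsV -cabsM.
apply: le_trans rP; rewrite -cabsN (_ : - (_ * _) = d - h^-1 *: (f (h *: 1 + z) - f z)) //.
rewrite (_ : h *: 1 = h) ?[h + z]addrC; last exact: mulr1.
by rewrite -[_ *: _]/(h^-1 * _); field.
Qed.

Lemma cdiff_derivable f z : cdiff f z -> derivable (f : R[i]^o -> R[i]^o) z 1.
Proof.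
move=> [d H]; apply/cvg_ex; exists d; apply/cvgrPdist_le => e e0.
have eR : e = (Re e)%:C by rewrite RRe_real// gtr0_real.
have [|r r0 rP] := H (Re e); first by move: e0; rewrite eR ltcR.
exists r%:C; first by rewrite /= ltcR.
move=> h; rewrite /ball_ /= sub0r normrN normC_cabs ltcR => hr h0.
rewrite normC_cabs eR lecR.
have := rP h hr; rewrite -ler_pdivrMr ?cabs_gt0// -cabsV -cabsM; apply: le_trans.
rewrite -cabsN (_ : - (d - _) = (f (z + h) - f z - d * h) / h) //.
rewrite (_ : h *: 1 = h) ?[h + z]addrC; last exact: mulr1.
by rewrite -[_ *: _]/(h^-1 * _); field.
Qed.

Lemma cdiffM f g z : cdiff f z -> cdiff g z -> cdiff (fun z => f z * g z) z.
Proof.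
move=> df dg; apply: derivable_cdiff.
have dM := @derivableM R[i] R[i]^o f g z 1 (cdiff_derivable df) (cdiff_derivable dg).
exact: dM.
Qed.

Lemma cdiffV f z : f z != 0 -> cdiff f z -> cdiff (fun z => (f z)^-1) z.
Proof.
move=> f0 df; apply: derivable_cdiff.
have dV := @derivableV R[i] R[i]^o f z 1 f0 (cdiff_derivable df).
exact: dV.
Qed.

Lemma cdiff_cst (c : R[i]) z : cdiff (fun=> c) z.
Proof.
exists 0 => e e0; exists 1 => // h _.
by rewrite mul0r !subrr cabs0 mulr_ge0 ?cabs_ge0// ltW.
Qed.

Lemma cdiff_affine (a b : R[i]) z : cdiff (fun z => a * z + b) z.
Proof.
exists a => e e0; exists 1 => // h _.
by rewrite (_ : _ - _ = 0) ?cabs0 ?mulr_ge0 ?cabs_ge0 ?ltW//; ring.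
Qed.

Lemma cdiff_continuous f z : cdiff f z -> forall e : R, 0 < e -> exists2 r : R, 0 < r &
  forall h, cabs h < r -> cabs (f (z + h) - f z) <= e.
Proof.
move=> [d /(_ _ ltr01)[r r0 H]] e e0.
have c0 : 0 < cabs d + 1 by rewrite ltr_wpDl// cabs_ge0.
exists (Num.min r (e / (cabs d + 1))) => [|h]; first by rewrite lt_min r0 divr_gt0.
rewrite lt_min ltr_pdivlMr// => /andP[/H hr he].
rewrite -[X in cabs X](subrK (d * h)) (le_trans (ler_cabsD _ _))// cabsM.
have : (1 + cabs d) * cabs h <= e by rewrite addrC mulrC ltW.
by apply: le_trans; rewrite mulrDl lerD2r.
Qed.

(** The form is Im(g dz). With g' = d1 + i d2, the Cauchy-Riemann equations give d_y(Im g) = d_x(Re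
    g) = d1, the shared coefficient, and the outer coefficients d2 and -d2. *)
Lemma cdiff_closed_at g (x y : R) : cdiff g (x +i* y) ->
  closed_at (fun x y => Im (g (x +i* y))) (fun x y => Re (g (x +i* y))) x y.
Proof.
move=> [[d1 d2] H]; exists d2, d1, (- d2) => e e0; have [r r0 rP] := H e e0.
exists (r / 2); first exact: divr_gt0.
move=> x' y' hx hy.
have hle : cabs ((x' - x) +i* (y' - y)) <= `|x' - x| + `|y' - y| by exact: cabs_le_ReIm.
have {}rP : cabs (g (x' +i* y') - g (x +i* y) - (d1 +i* d2) * ((x' - x) +i* (y' - y)))
    <= e * (`|x' - x| + `|y' - y|).
  have -> : x' +i* y' = x +i* y + ((x' - x) +i* (y' - y)).
    by apply: complex_ext; rewrite ReImE /=; ring.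
  apply: (le_trans (rP _ _)); last by rewrite ler_pM2l.
  by apply: le_lt_trans hle _; lra.
split; apply: le_trans rP.
- apply: le_trans (normr_Im_le _); rewrite !ReImE /=.
  by rewrite [d1 * _ + _]addrC.
- by apply: le_trans (normr_Re_le _); rewrite !ReImE /= mulNr.
Qed.

End ComplexDerivative.

(** * Cauchy's estimate *)

Section Continuity.
Variable R : realType.
Implicit Types f g : R[i] -> R[i].

Lemma ler_dist_cabs (z w : R[i]) : `|cabs z - cabs w| <= cabs (z - w).
Proof.
have := ler_cabsD (z - w) w; have := ler_cabsD (w - z) z.
rewrite !subrK -(cabsN (w - z)) opprB => h1 h2.
by rewrite ler_norml; apply/andP; split; lra.
Qed.

Lemma cdiff_cabs_continuous f (x y : R) : cdiff f (x +i* y) ->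
  {for (x, y), continuous (fun xy : R * R => cabs (f (xy.1 +i* xy.2)))}.
Proof.
move=> fz; apply/cvgrPdist_le => e e0; have [r r0 rP] := cdiff_continuous fz e0.
exists (ball x (r / 2), ball y (r / 2)) => /=.
  by split; exact: nbhsx_ballx (divr_gt0 r0 _).
move=> [x' y'] [/=]; rewrite /ball /= => hx hy.
rewrite distrC (le_trans (ler_dist_cabs _ _))//.
have -> : x' +i* y' = x +i* y + ((x' - x) +i* (y' - y)).
  by apply: complex_ext; rewrite ReImE /=; ring.
apply: rP; apply: le_lt_trans (cabs_le_ReIm _) _ => /=.
by rewrite distrC [X in _ + X]distrC; lra.
Qed.

Lemma cdiff_cabs_continuous_x f (x y : R) : cdiff f (x +i* y) ->
  {for x, continuous (fun x => cabs (f (x +i* y)))}.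
Proof.
move=> /cdiff_cabs_continuous fc.
apply: (@continuous_comp _ _ _ (fun x => (x, y)) (fun xy => cabs (f (xy.1 +i* xy.2)))) => //.
exact: (@cvg_pair _ _ _ (nbhs x) (nbhs x) (nbhs y) _ _ _ id (fun=> y) cvg_id (cvg_cst _)).
Qed.

Lemma cdiff_cabs_continuous_y f (x y : R) : cdiff f (x +i* y) ->
  {for y, continuous (fun y => cabs (f (x +i* y)))}.
Proof.
move=> /cdiff_cabs_continuous fc.
apply: (@continuous_comp _ _ _ (fun y => (x, y)) (fun xy => cabs (f (xy.1 +i* xy.2)))) => //.
exact: (@cvg_pair _ _ _ (nbhs y) (nbhs x) (nbhs y) _ _ _ (fun=> x) id (cvg_cst _) cvg_id).
Qed.

End Continuity.

Section CauchyEstimate.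
Variable R : realType.

Lemma IsegZ (k : R) (f : R -> R) a b : cont_seg f a b ->
  Iseg (fun x => k * f x) a b = k * Iseg f a b.
Proof. by move=> cf; rewrite /Iseg RintegralZl//; exact: cont_seg_integrable. Qed.

(** Pointwise bound for the Cauchy kernel on a side at distance [e] from the centre: the numerator
    is at least (3/4 - 1/4) m e, the denominator at most 2 e^2. *)
Lemma kernel_lb (m e U V Y : R) : 0 < e -> 0 <= m -> `|Y| <= e -> `|U - m| <= m / 4 -> `|V| <= m / 4 ->
  m / (4 * e) <= (U * e + V * Y) / (e ^+ 2 + Y ^+ 2).
Proof.
move=> e0 m0 Ye Um Vm.
have e2 : 0 < e ^+ 2 by rewrite exprn_gt0.
have Y2 : Y ^+ 2 <= e ^+ 2 by rewrite -real_normK ?num_real// lerXn2r// ?nnegrE// ltW.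
have den : 0 < e ^+ 2 + Y ^+ 2 by rewrite ltr_wpDr// sqr_ge0.
rewrite ler_pdivlMr//.
have VY : - (m / 4 * e) <= V * Y.
  suff : `|V * Y| <= m / 4 * e by rewrite ler_norml => /andP[].
  by rewrite normrM ler_pM.
have UE : m * e - m / 4 * e <= U * e.
  by rewrite -mulrBl ler_pM2r//; move: Um; rewrite ler_norml => /andP[]; lra.
apply: (@le_trans _ _ (m / (4 * e) * (2 * e ^+ 2))).
  by rewrite ler_wpM2l ?divr_ge0 ?mulr_ge0 ?(ltW e0)//; lra.
have -> : m / (4 * e) * (2 * e ^+ 2) = m * e / 2 by field; rewrite gt_eqF.
lra.
Qed.

Variables (f : R[i] -> R[i]) (u : R[i]).
Hypothesis df : forall z, cdiff f z.

Local Notation u1 := (Re u).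
Local Notation u2 := (Im u).
(** The factor conj(f u) makes F(u) = |f u|^2 real and nonnegative, so the residue of [g] at [u]
    shows up entirely in the imaginary part of the integral of g dz, and no complex-valued integral
    is needed. *)
Let F (z : R[i]) : R[i] := (f u)^* * f z.
Let g (z : R[i]) : R[i] := F z / (z - u).
Let P (x y : R) := Im (g (x +i* y)).
Let Q (x y : R) := Re (g (x +i* y)).
Let m := cabs (f u) ^+ 2.

Let Fu : F u = m%:C.
Proof. by rewrite /m sqr_cabs /F; case: (f u) => a b; apply: complex_ext => /=; ring. Qed.

Let PE x y : P x y = (Im (F (x +i* y)) * (x - u1) + Re (F (x +i* y)) * (u2 - y)) /
  ((x - u1) ^+ 2 + (u2 - y) ^+ 2).
Proof.
rewrite /P /g; case: u => a b; case: (F _) => c d /=.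
rewrite -[(b - y) ^+ 2]sqrrN opprB; ring.
Qed.

Let QE x y : Q x y = (Re (F (x +i* y)) * (x - u1) + Im (F (x +i* y)) * (y - u2)) /
  ((x - u1) ^+ 2 + (y - u2) ^+ 2).
Proof. by rewrite /Q /g; case: u => a b; case: (F _) => c d /=; ring. Qed.

Let cabs_conj (z : R[i]) : cabs (z^*) = cabs z.
Proof. by case: z => a b; rewrite /cabs /= sqrrN. Qed.

Let gC x y : x != u1 \/ y != u2 -> closed_at P Q x y.
Proof.
move=> xy; apply: cdiff_closed_at; rewrite /g /F; apply: cdiffM.
  by apply: cdiffM => //; exact: cdiff_cst.
apply: cdiffV; last by rewrite (_ : (fun z => z - u) = (fun z => 1 * z + - u)) ?mul1r;
  [exact: cdiff_affine|apply/funext => z; rewrite mul1r].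
rewrite subr_eq0 eq_complex negb_and /=; by apply/orP.
Qed.

Let contP a b y : y != u2 -> cont_seg (P ^~ y) a b.
Proof. by move=> yu x _; have [] := closed_at_continuous (@gC x y (or_intror yu)). Qed.

Let contQ a b x : x != u1 -> cont_seg (Q x) a b.
Proof. by move=> xu y _; have [] := closed_at_continuous (@gC x y (or_introl xu)). Qed.

Let cabs_g (z : R[i]) : (1/2 : R) <= cabs (z - u) -> cabs (g z) <= 2 * cabs (f u) * cabs (f z).
Proof.
move=> zu; have zu0 : 0 < cabs (z - u) by apply: lt_le_trans zu; lra.
rewrite /g /F !cabsM cabs_conj cabsV ler_pdivrMr//.
rewrite (_ : 2 * _ * _ * _ = cabs (f u) * cabs (f z) * (2 * cabs (z - u))); last by ring.
rewrite ler_peMr//.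
  by rewrite mulr_ge0 ?cabs_ge0.
lra.
Qed.

Variables x1 x2 y1 y2 : R.
Hypotheses (hx1 : x1 <= u1 - 1/2) (hx2 : u1 + 1/2 <= x2) (hy1 : y1 <= u2 - 1/2) (hy2 : u2 + 1/2 <= y2).

Definition boundary_mass :=
  Iseg (fun x => cabs (f (x +i* y1)) + cabs (f (x +i* y2))) x1 x2 +
  Iseg (fun y => cabs (f (x2 +i* y)) + cabs (f (x1 +i* y))) y1 y2.

Let cont_fx y a b : cont_seg (fun x => cabs (f (x +i* y))) a b.
Proof. by move=> x _; exact: cdiff_cabs_continuous_x. Qed.

Let cont_fy x a b : cont_seg (fun y => cabs (f (x +i* y))) a b.
Proof. by move=> y _; exact: cdiff_cabs_continuous_y. Qed.

(** Every side is at distance at least 1/2 from [u], which is where the factor 2 comes from. *)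
Let circ_ub : circ P Q (Rect x1 x2 y1 y2) <= 2 * cabs (f u) * boundary_mass.
Proof.
have [k1 k2 k3 k4] := And4 hx1 hx2 hy1 hy2.
rewrite /circ /boundary_mass mulrDr /= -!IsegZ; do ?exact: cont_segD.
have ne1 : x1 != u1 by rewrite lt_eqF//; lra.
have ne2 : x2 != u1 by rewrite gt_eqF//; lra.
have ne3 : y1 != u2 by rewrite lt_eqF//; lra.
have ne4 : y2 != u2 by rewrite gt_eqF//; lra.
have cZ k (h : R -> R) a b : cont_seg h a b -> cont_seg (fun x => k * h x) a b.
  by move=> ch x xab; apply: continuousM; [exact: cvg_cst|exact: ch].
have ImB (z w : R[i]) : Im z - Im w <= cabs z + cabs w.
  have := normr_Im_le z; have := normr_Im_le w; rewrite !ler_norml => /andP[? ?] /andP[? ?]; lra.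
have ReB (z w : R[i]) : Re z - Re w <= cabs z + cabs w.
  have := normr_Re_le z; have := normr_Re_le w; rewrite !ler_norml => /andP[? ?] /andP[? ?]; lra.
have far (z : R[i]) : 1/2 <= `|Re z - u1| \/ 1/2 <= `|Im z - u2| -> 1/2 <= cabs (z - u).
  move=> [h|h]; apply: le_trans h _.
    by have := normr_Re_le (z - u); rewrite ReD ReN.
  by have := normr_Im_le (z - u); rewrite ImD ImN.
apply: lerD; (apply: Iseg_le; [|by apply: cZ; exact: cont_segD|]).
- by apply: cont_segB; exact: contP.
- move=> x _; rewrite /P; apply: (le_trans (ImB _ _)); rewrite mulrDr.
  by apply: lerD; apply: cabs_g; apply: far; right => /=; rewrite ler_normr; apply/orP;
    [right|left]; lra.
- by apply: cont_segB; exact: contQ.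
- move=> x _; rewrite /Q; apply: (le_trans (ReB _ _)); rewrite mulrDr.
  by apply: lerD; apply: cabs_g; apply: far; left => /=; rewrite ler_normr; apply/orP;
    [left|right]; lra.
Qed.

Let small_square : f u != 0 -> exists2 e, 0 < e <= 1/2 & forall x y, `|x - u1| <= e -> `|y - u2| <= e ->
  `|Re (F (x +i* y)) - m| <= m / 4 /\ `|Im (F (x +i* y))| <= m / 4.
Proof.
move=> fu0; have fu0' : 0 < cabs (f u) by rewrite cabs_gt0.
have [r r0 rP] := cdiff_continuous (df u) (divr_gt0 fu0' (ltr0n _ 4)).
(* 1/2 keeps the square inside the rectangle; r / 4 on each coordinate keeps the modulus of the
   increment below r. *)
exists (Num.min (1/2) (r / 4)).
  by rewrite lt_min ge_min lexx divr_gt0//= divr_gt0.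
move=> x y; rewrite !le_min => /andP[_ hx] /andP[_ hy].
set h : R[i] := (x - u1) +i* (y - u2).
have hr : cabs h < r by apply: le_lt_trans (cabs_le_ReIm _) _; rewrite /h /=; lra.
have E : x +i* y = u + h by apply: complex_ext; rewrite ?ReD ?ImD /h /=; ring.
have H : cabs (F (x +i* y) - m%:C) <= m / 4.
  rewrite -Fu /F -mulrBr cabsM cabs_conj E /m expr2 -mulrA ler_pM2l//; exact: rP.
split; apply: le_trans H.
  by have := normr_Re_le (F (x +i* y) - m%:C); rewrite ReImE ReN ReC.
by have := normr_Im_le (F (x +i* y) - m%:C); rewrite ImD ImN ImC oppr0 addr0.
Qed.

(** The value for small [e] is close to 2 pi m; the crude 2 m is enough. By [kernel_lb] each side
    contributes at least m / (4 e) per unit of length, so a pair of opposite sides of length 2 e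
    contributes m. *)
Let circ_lb e : 0 < e -> (forall x y, `|x - u1| <= e -> `|y - u2| <= e ->
    `|Re (F (x +i* y)) - m| <= m / 4 /\ `|Im (F (x +i* y))| <= m / 4) ->
  2 * m <= circ P Q (Rect (u1 - e) (u1 + e) (u2 - e) (u2 + e)).
Proof.
move=> e0 H; rewrite /circ /= mulr_natl mulr2n.
have m0 : 0 <= m by rewrite exprn_ge0 ?cabs_ge0.
have en0 : e != 0 by rewrite gt_eqF.
have ne1 : u1 - e != u1 by rewrite -subr_eq0 addrAC subrr add0r oppr_eq0.
have ne2 : u1 + e != u1 by rewrite -subr_eq0 addrAC subrr add0r.
have ne3 : u2 - e != u2 by rewrite -subr_eq0 addrAC subrr add0r oppr_eq0.
have ne4 : u2 + e != u2 by rewrite -subr_eq0 addrAC subrr add0r.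
have I v : m = Iseg (fun=> m / (2 * e)) (v - e) (v + e).
  by rewrite Iseg_cst; [field|lra].
have absP (v w : R) : v - e <= w <= v + e -> `|w - v| <= e.
  by move=> /andP[? ?]; rewrite ler_norml; apply/andP; split; lra.
have eP v : `|v + e - v| <= e by rewrite addrAC subrr add0r ger0_norm// ltW.
have eN v : `|v - e - v| <= e by rewrite addrAC subrr add0r normrN ger0_norm// ltW.
have half : m / (2 * e) = m / (4 * e) + m / (4 * e) by field.
apply: lerD.
- rewrite [X in X <= _](I u1); apply: Iseg_le; first exact: cont_seg_cst.
    by apply: cont_segB; exact: contP.
  move=> x /absP xP; rewrite half !PE.
  have [h1 h2] := H x (u2 - e) xP (eN _); have [h3 h4] := H x (u2 + e) xP (eP _).
  have k1 := kernel_lb e0 m0 xP h1 h2.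
  rewrite -normrN in h4; have k2 := kernel_lb e0 m0 xP h3 h4.
  apply: le_trans (lerD k1 k2) _.
  by rewrite le_eqVlt; apply/orP; left; apply/eqP; rewrite -mulNr; congr (_ / _ + _ / _); ring.
- rewrite [X in X <= _](I u2); apply: Iseg_le; first exact: cont_seg_cst.
    by apply: cont_segB; exact: contQ.
  move=> y /absP yP; rewrite half !QE.
  have [h1 h2] := H (u1 + e) y (eP _) yP; have [h3 h4] := H (u1 - e) y (eN _) yP.
  have k1 := kernel_lb e0 m0 yP h1 h2.
  rewrite -normrN in h4; have k2 := kernel_lb e0 m0 yP h3 h4.
  apply: le_trans (lerD k1 k2) _.
  by rewrite le_eqVlt; apply/orP; left; apply/eqP; rewrite -mulNr; congr (_ / _ + _ / _); ring.
Qed.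

(* Cut the rectangle into a square around u and four rectangles avoiding u. *)
Let circ_shrink e : 0 < e <= 1/2 ->
  circ P Q (Rect x1 x2 y1 y2) = circ P Q (Rect (u1 - e) (u1 + e) (u2 - e) (u2 + e)).
Proof.
have [k1 k2 k3 k4] := And4 hx1 hx2 hy1 hy2.
move=> /andP[e0 e1].
have ux1 : x1 != u1 by rewrite lt_eqF//; lra.
have ux2 : u1 - e != u1 by rewrite lt_eqF//; lra.
have ux3 : u1 + e != u1 by rewrite gt_eqF//; lra.
have ux4 : x2 != u1 by rewrite gt_eqF//; lra.
have uy1 : y1 != u2 by rewrite lt_eqF//; lra.
have uy2 : u2 - e != u2 by rewrite lt_eqF//; lra.
have uy3 : u2 + e != u2 by rewrite gt_eqF//; lra.
have uy4 : y2 != u2 by rewrite gt_eqF//; lra.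
have in3 (v a b c : R) : a != v -> b != v -> c != v -> forall t, t \in [:: a; b; c] -> t != v.
  by move=> ? ? ? t; rewrite !inE => /or3P[] /eqP ->.
have cP (a b : R) (p q r : R) : p != u2 -> q != u2 -> r != u2 ->
    forall t, t \in [:: p; q; r] -> cont_seg (P ^~ t) a b.
  by move=> h1 h2 h3 t tin; apply: contP; exact: in3 tin.
have cQ (a b : R) (p q r : R) : p != u1 -> q != u1 -> r != u1 ->
    forall t, t \in [:: p; q; r] -> cont_seg (Q t) a b.
  by move=> h1 h2 h3 t tin; apply: contQ; exact: in3 tin.
have zero a b c d : a <= b -> c <= d -> u1 < a \/ b < u1 \/ u2 < c \/ d < u2 ->
    circ P Q (Rect a b c d) = 0.
  move=> ab cd out; apply: circ_closed => //= x y [/= /andP[xa xb] /andP[yc yd]]; apply: gC.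
  by case: out => [h|[h|[h|h]]]; [left|left|right|right]; apply/eqP => E; move: h; lra.
rewrite (@circ_hsplit R P Q x1 x2 y1 (u2 - e) y2); last first.
- exact: cP.
- exact: contQ.
- exact: contQ.
- by apply/andP; split; lra.
rewrite (@circ_hsplit R P Q x1 x2 (u2 - e) (u2 + e) y2); last first.
- exact: cP.
- exact: contQ.
- exact: contQ.
- by apply/andP; split; lra.
rewrite (@circ_vsplit R P Q x1 (u1 - e) x2 (u2 - e) (u2 + e)); last first.
- exact: cQ.
- exact: contP.
- exact: contP.
- by apply/andP; split; lra.
rewrite (@circ_vsplit R P Q (u1 - e) (u1 + e) x2 (u2 - e) (u2 + e)); last first.
- exact: cQ.
- exact: contP.
- exact: contP.
- by apply/andP; split; lra.
rewrite (zero x1 x2 y1 (u2 - e)); [|lra|lra|by do 3 right; lra].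
rewrite (zero x1 x2 (u2 + e) y2); [|lra|lra|by do 2 right; left; lra].
rewrite (zero x1 (u1 - e) (u2 - e) (u2 + e)); [|lra|lra|by right; left; lra].
rewrite (zero (u1 + e) x2 (u2 - e) (u2 + e)); [|lra|lra|by left; lra].
by rewrite !add0r !addr0.
Qed.

(** The circulation lies between 2 |f u|^2 (on the small square) and 2 |f u| times the boundary mass
    (on the large rectangle); divide by 2 |f u|. *)
Lemma cauchy_boundary_estimate : cabs (f u) <= boundary_mass.
Proof.
have [k1 k2 k3 k4] := And4 hx1 hx2 hy1 hy2.
have [->|fu0] := eqVneq (f u) 0.
  have I (h : R -> R) a b : cont_seg h a b -> a <= b -> (forall x, 0 <= h x) -> 0 <= Iseg h a b.
    move=> ch ab h0; rewrite -[X in X <= _](mul0r (b - a)) -Iseg_cst//.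
    by apply: Iseg_le => //; exact: cont_seg_cst.
  rewrite cabs0 addr_ge0//; apply: I; do ?[exact: cont_segD]; do ?[lra];
    by move=> x; rewrite addr_ge0 ?cabs_ge0.
have [e e1 H] := small_square fu0; have /andP[e0 _] := e1.
have := circ_lb e0 H; rewrite -(circ_shrink e1) => /le_trans/(_ circ_ub).
by rewrite /m expr2 mulrA ler_pM2l ?mulr_gt0 ?cabs_gt0.
Qed.

End CauchyEstimate.

(** * Measurability and Gaussian integrals in the plane; from boundary to area *)

Section PlaneMeasure.
Variable R : realType.
Local Notation mu := (@lebesgue_measure R).

(** Links the product topology with the product sigma-algebra: an open set is the countable union of
    the boxes with rational corners that it contains. *)
Lemma open_plane_measurable (O : set (R * R)) : open O -> measurable O.
Proof.
move=> oO.
pose box (i : (rat * rat) * (rat * rat)) : set (R * R) :=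
  `]ratr i.1.1, ratr i.1.2[%classic `*` `]ratr i.2.1, ratr i.2.2[%classic.
have -> : O = \bigcup_i (if `[< box i `<=` O >] then box i else set0).
  apply/seteqP; split => [[x y] Oxy|[x y] [i _]]; last by case: asboolP => // H /H.
  have [[A B] [/= nA nB] AB] := oO _ Oxy.
  have [r1 r1P] : exists r : {posnum R}, forall z, `|x - z| < r%:num -> A z.
    by have [r r0 rA] := nA; exists (PosNum r0).
  have [r2 r2P] : exists r : {posnum R}, forall z, `|y - z| < r%:num -> B z.
    by have [r r0 rB] := nB; exists (PosNum r0).
  have lt1 (z : R) (r : {posnum R}) : z - r%:num < z by rewrite ltrBlDr ltrDl.
  have lt2 (z : R) (r : {posnum R}) : z < z + r%:num by rewrite ltrDl.
  have [q1] := rat_in_itvoo (lt1 x r1); rewrite in_itv /= => /andP[q1l q1r].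
  have [q2] := rat_in_itvoo (lt2 x r1); rewrite in_itv /= => /andP[q2l q2r].
  have [q3] := rat_in_itvoo (lt1 y r2); rewrite in_itv /= => /andP[q3l q3r].
  have [q4] := rat_in_itvoo (lt2 y r2); rewrite in_itv /= => /andP[q4l q4r].
  exists ((q1, q2), (q3, q4)) => //; case: asboolP => [_|]; last case.
    by split; rewrite /= in_itv /= ?q1r ?q2l ?q3r ?q4l.
  move=> [z w] [/=]; rewrite !in_itv /= => /andP[z1 z2] /andP[w1 w2]; apply: AB; split => /=.
    by apply: r1P; rewrite ltr_norml; apply/andP; split; lra.
  by apply: r2P; rewrite ltr_norml; apply/andP; split; lra.
apply: countable_bigcupT_measurable => // i; case: asboolP => // _.
by apply: measurableX; exact: measurable_itv.
Qed.

Lemma continuous_plane_measurable (h : R * R -> R) : continuous h -> measurable_fun setT h.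
Proof.
move=> /continuousP ch; apply: (measurability _ (measurable_realfun.RGenOpens.measurableE R)).
move=> _ [_ [a [b ->] <-]]; rewrite setTI; apply: open_plane_measurable.
exact/ch/interval_open.
Qed.

(** The normal density of mean [m] and variance 1/(2k) has total mass one; its peak is the inverse
    of the right-hand side. *)
Lemma integral_gauss (k m : R) : 0 < k ->
  (\int[mu]_x (expR (- (k * (x - m) ^+ 2)))%:E)%E = (Num.sqrt (pi / k))%:E.
Proof.
move=> k0.
pose s := Num.sqrt ((2 * k)^-1).
have s2 : s ^+ 2 = (2 * k)^-1 by rewrite sqr_sqrtr// invr_ge0 mulr_ge0// ltW.
have s0 : s != 0 by rewrite gt_eqF// sqrtr_gt0 invr_gt0 mulr_gt0.
have := integral_normal_pdf m s; rewrite (normal_pdfE m s0) => H.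
have E x : normal_fun m s x = expR (- (k * (x - m) ^+ 2)).
  by rewrite /normal_fun s2; congr expR; field; rewrite gt_eqF.
have P : normal_peak s = (Num.sqrt (pi / k))^-1.
  by rewrite /normal_peak s2; congr (Num.sqrt _)^-1; field; rewrite gt_eqF.
have q0 : 0 < Num.sqrt (pi / k) by rewrite sqrtr_gt0 divr_gt0 ?pi_gt0.
have {}H : ((normal_peak s)%:E * \int[mu]_x (expR (- (k * (x - m) ^+ 2)))%:E = 1)%E.
  rewrite -H -ge0_integralZl//=.
  - by apply: eq_integral => x _; rewrite -E -EFinM.
  - apply/measurable_EFinP; under eq_fun do rewrite -E; exact: measurable_normal_fun.
  - by rewrite lee_fin normal_peak_ge0.
have := congr1 (fun t => ((Num.sqrt (pi / k))%:E * t)%E) H.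
by rewrite muleA -EFinM P mulfV ?gt_eqF// mul1e mule1.
Qed.

End PlaneMeasure.

Section AreaEstimate.
Variable R : realType.
Local Notation mu := (@lebesgue_measure R).

Lemma Iseg_EFin (f : R -> R) a b : cont_seg f a b ->
  (Iseg f a b)%:E = (\int[mu]_(x in `[a, b]) (f x)%:E)%E.
Proof.
move=> cf; rewrite /Iseg /Rintegral fineK//; apply: integrable_fin_num => //.
exact: cont_seg_integrable.
Qed.

Lemma exists_small_value (h : R -> \bar R) (p t : R) : measurable_fun setT h -> (forall x, 0 <= h x)%E ->
  (\int[mu]_x h x < (t / 2)%:E)%E -> exists x, p <= x <= p + 1/2 /\ (h x < t%:E)%E.
Proof.
move=> mh h0 Ih; apply: contrapT => H.
have hge x : p <= x <= p + 1/2 -> (t%:E <= h x)%E.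
  by move=> xp; rewrite leNgt; apply/negP => hx; apply: H; exists x.
move: Ih; apply/negP; rewrite -leNgt.
have [t0|t0] := leP t 0.
  by apply: (@le_trans _ _ 0%E); [rewrite lee_fin; lra|exact: integral_ge0].
apply: (@le_trans _ _ (\int[mu]_(x in `[p, (p + 1/2)%R]) h x)%E); last first.
  by apply: ge0_subset_integral.
have -> : (t / 2)%:E = (\int[mu]_(x in `[p, (p + 1/2)%R]) (cst t%:E) x)%E.
  rewrite integral_cst//= lebesgue_measure_itv /= lte_fin ifT; last by lra.
  by rewrite -EFinB -EFinM; congr EFin; field.
apply: ge0_le_integral => //.
- by move=> x _; rewrite lee_fin ltW.
- exact: measurable_funTS.
Qed.

Variables (f : R[i] -> R[i]) (u : R[i]) (H : R * R -> R).
Hypothesis df : forall z, cdiff f z.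
Hypothesis mH : measurable_fun setT H.
Hypothesis H0 : forall xy, 0 <= H xy.
Hypothesis fH : forall x y, `|x - Re u| <= 1 -> `|y - Im u| <= 1 -> cabs (f (x +i* y)) <= H (x, y).

Let I := (\int[(mu \x mu)%E]_xy (H xy)%:E)%E.

Let small_x p t : (I < (t / 2)%:E)%E ->
  exists x, p <= x <= p + 1/2 /\ (\int[mu]_y (H (x, y))%:E < t%:E)%E.
Proof.
have mHE : measurable_fun setT (fun xy => (H xy)%:E) by exact/measurable_EFinP.
have HE0 xy : (0 <= (H xy)%:E)%E by rewrite lee_fin.
move=> It; apply: exists_small_value.
- exact: (measurable_fun_fubini_tonelli_F (m2 := mu) _ mHE HE0).
- by move=> x; apply: integral_ge0.
- by move: It; rewrite /I (fubini_tonelli1 (m1 := mu) (m2 := mu) _ mHE HE0).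
Qed.

Let small_y p t : (I < (t / 2)%:E)%E ->
  exists y, p <= y <= p + 1/2 /\ (\int[mu]_x (H (x, y))%:E < t%:E)%E.
Proof.
have mHE : measurable_fun setT (fun xy => (H xy)%:E) by exact/measurable_EFinP.
have HE0 xy : (0 <= (H xy)%:E)%E by rewrite lee_fin.
move=> It; apply: exists_small_value.
- exact: (measurable_fun_fubini_tonelli_G (m1 := mu) _ mHE HE0).
- by move=> x; apply: integral_ge0.
- by move: It; rewrite /I (fubini_tonelli2 (m1 := mu) (m2 := mu) _ mHE HE0).
Qed.

Let Iseg_le_int (g h : R -> R) a b t : cont_seg g a b -> (forall x, a <= x <= b -> g x <= h x) ->
  (forall x, 0 <= g x) -> (forall x, 0 <= h x) -> measurable_fun setT h ->
  (\int[mu]_x (h x)%:E < t%:E)%E -> Iseg g a b < t.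
Proof.
move=> cg gh g0 h0 mh; rewrite -lte_fin Iseg_EFin//; apply: le_lt_trans.
apply: (@le_trans _ _ (\int[mu]_(x in `[a, b]) (h x)%:E)%E).
  apply: ge0_le_integral => //.
  - by move=> x _; rewrite lee_fin.
  - by have /integrableP[] := cont_seg_integrable cg.
  - by apply/measurable_EFinP; exact: measurable_funTS.
apply: ge0_subset_integral => //; first exact/measurable_EFinP.
by move=> x _; rewrite lee_fin.
Qed.

(** Otherwise I < t/2 with t = |f u| / 4. Each of the four strips of width 1/2, at distance between
    1/2 and 1 from [u], then contains by Tonelli a line on which [H] integrates to less than t. The
    rectangle cut out by these lines has boundary mass below 4 t = |f u|, against the boundary
    estimate. *)
Lemma cauchy_area_estimate : ((cabs (f u))%:E <= 8%:E * I)%E.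
Proof.
rewrite leNgt; apply/negP => lt.
set t := cabs (f u) / 4.
have It : (I < (t / 2)%:E)%E.
  rewrite (_ : t / 2 = (8^-1) * cabs (f u)); last by rewrite /t; field.
  move: lt; rewrite -(@lte_pmul2l _ (8^-1)%:E) ?lte_fin ?invr_gt0// muleA -!EFinM.
  by rewrite mulVf// mul1e.
have [x1 [/andP[x1l x1r] X1]] := small_x (Re u - 1) It.
have [x2 [/andP[x2l x2r] X2]] := small_x (Re u + 1/2) It.
have [y1 [/andP[y1l y1r] Y1]] := small_y (Im u - 1) It.
have [y2 [/andP[y2l y2r] Y2]] := small_y (Im u + 1/2) It.
have cx y a b : cont_seg (fun x => cabs (f (x +i* y))) a b.
  by move=> x _; exact: cdiff_cabs_continuous_x.
have cy x a b : cont_seg (fun y => cabs (f (x +i* y))) a b.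
  by move=> y _; exact: cdiff_cabs_continuous_y.
have B : boundary_mass f x1 x2 y1 y2 < t + t + (t + t).
  rewrite /boundary_mass !IsegD//; apply: ltrD; apply: ltrD.
  - apply: (@Iseg_le_int _ (fun x => H (x, y1))) => //.
    + move=> x /andP[? ?]; apply: fH; rewrite ler_norml; apply/andP; split; lra.
    + by move=> x; exact: cabs_ge0.
    + exact: measurable_fun_pair1.
  - apply: (@Iseg_le_int _ (fun x => H (x, y2))) => //.
    + move=> x /andP[? ?]; apply: fH; rewrite ler_norml; apply/andP; split; lra.
    + by move=> x; exact: cabs_ge0.
    + exact: measurable_fun_pair1.
  - apply: (@Iseg_le_int _ (fun y => H (x2, y))) => //.
    + move=> x /andP[? ?]; apply: fH; rewrite ler_norml; apply/andP; split; lra.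
    + by move=> x; exact: cabs_ge0.
    + exact: measurable_fun_pair2.
  - apply: (@Iseg_le_int _ (fun y => H (x1, y))) => //.
    + move=> x /andP[? ?]; apply: fH; rewrite ler_norml; apply/andP; split; lra.
    + by move=> x; exact: cabs_ge0.
    + exact: measurable_fun_pair2.
have := @cauchy_boundary_estimate R f u df x1 x2 y1 y2.
have -> : cabs (f u) = t + t + (t + t) by rewrite /t; field.
move=> /(_ ltac:(lra) ltac:(lra) ltac:(lra) ltac:(lra)) /le_lt_trans /(_ B).
by rewrite ltxx.
Qed.

End AreaEstimate.

(** * The complex exponential and the Fock weight *)

Section ComplexExponential.
Variable R : realType.

Lemma cexpD (z w : R[i]) : cexp (z + w) = cexp z * cexp w.
Proof.
case: z w => [a b] [c d]; rewrite /cexp /= expRD cosD sinD.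
by apply: complex_ext => /=; ring.
Qed.

Lemma cabs_cexp (z : R[i]) : cabs (cexp z) = expR (Re z).
Proof.
rewrite /cabs /cexp /= !exprMn -mulrDr cos2Dsin2 mulr1 sqrtr_sqr ger0_norm//.
Qed.

Lemma first_order_at0 (f : R -> R) (d : R) : is_derive (0:R) 1 f d ->
  forall e, 0 < e -> exists2 r, 0 < r & forall x, `|x| < r -> `|f x - f 0 - d * x| <= e * `|x|.
Proof.
move=> [df fd] e e0.
have /cvgrPdist_le/(_ _ e0) [r /= r0 rP] := df; exists r => // x xr.
have [->|x0] := eqVneq x 0; first by rewrite subrr mulr0 subr0 normr0 mulr0.
have := rP x; rewrite /ball_ /= sub0r normrN => /(_ xr x0).
rewrite -[lim _]/(derive f 0 1) fd addr0 [_%:A]mulr1 -[_ *: _]/(_ * _) => H.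
rewrite -ler_pdivrMr ?normr_gt0// -normfV -normrM -normrN; apply: le_trans H.
by rewrite le_eqVlt; apply/orP; left; apply/eqP; congr (`|_|); field.
Qed.

Lemma cexp_first_order (e : R) : 0 < e -> exists2 r : R, 0 < r &
  forall h : R[i], cabs h < r -> cabs (cexp h - 1 - h) <= e * cabs h.
Proof.
(* The 9 counts the error terms, in units of d N: 1 for expR x - 1 - x, 3 each for the cosine and
   sine errors multiplied by expR x <= 3, and 2 for (expR x - 1) y. *)
move=> e0; have e6 : 0 < Num.min 1 (e / 9) by rewrite lt_min ltr01 divr_gt0.
have [r1 r10 H1] := first_order_at0 (is_derive_expR (0:R)) e6.
have [r2 r20 H2] := first_order_at0 (is_derive_cos (0:R)) e6.
have [r3 r30 H3] := first_order_at0 (is_derive_sin (0:R)) e6.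
set d := Num.min 1 (e / 9) in e6 H1 H2 H3 *.
exists (Num.min (Num.min 1 r1) (Num.min (Num.min r2 d) r3)); first by rewrite !lt_min ltr01 r10 r20 r30 divr_gt0.
have d1 : d <= 1 by rewrite ge_min lexx.
have de : d <= e / 9 by rewrite ge_min lexx orbT.
case=> x y; rewrite !lt_min => /andP[/andP[h1 hr1] /andP[/andP[hr2 hd] hr3]].
set N := cabs (x +i* y) in h1 hr1 hr2 hd hr3 *.
have xN : `|x| <= N by exact: (normr_Re_le (x +i* y)).
have yN : `|y| <= N by exact: (normr_Im_le (x +i* y)).
have := H1 x (le_lt_trans xN hr1); rewrite expR0 mul1r => Hx.
have := H2 y (le_lt_trans yN hr2); rewrite cos0 sin0 oppr0 mul0r subr0 => Hc.
have := H3 y (le_lt_trans yN hr3); rewrite sin0 cos0 mul1r subr0 => Hs.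
have dN (k : R) : `|k| <= N -> d * `|k| <= d * N by move=> ?; rewrite ler_pM2l.
have {}Hx := le_trans Hx (dN _ xN); have {}Hc := le_trans Hc (dN _ yN).
have {}Hs := le_trans Hs (dN _ yN).
have N0 : 0 <= N by exact: cabs_ge0.
have dN1 : d * N <= N by rewrite ler_piMl.
have ex3 : expR x <= 3.
  move: Hx; rewrite ler_norml => /andP[_]; have := ler_norm x; lra.
have ex0 := expR_ge0 x.
apply: le_trans (cabs_le_ReIm _) _ => /=; rewrite subr0.
have -> : expR x * cos y - 1 - x = (expR x - 1 - x) + expR x * (cos y - 1) by ring.
have -> : expR x * sin y - y = expR x * (sin y - y) + ((expR x - 1 - x) + x) * y by ring.
have t1 : `|expR x * (cos y - 1)| <= 3 * (d * N) by rewrite normrM ler_pM// ger0_norm.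
have t2 : `|expR x * (sin y - y)| <= 3 * (d * N) by rewrite normrM ler_pM// ger0_norm.
have t3 : `|(expR x - 1 - x + x) * y| <= (d * N + N) * d.
  rewrite normrM ler_pM//; first by rewrite (le_trans (ler_normD _ _))// lerD.
  by apply: le_trans yN _; rewrite le_min; case/andP: hd => /ltW -> /ltW ->.
have t4 : d * (d * N) <= d * N by rewrite ler_pM2l.
have t5 : d * N <= e / 9 * N by rewrite ler_wpM2r.
have := ler_normD (expR x - 1 - x) (expR x * (cos y - 1)).
have := ler_normD (expR x * (sin y - y)) ((expR x - 1 - x + x) * y).
have -> : e * N = 9 * (e / 9 * N) by field.
move: t3; rewrite mulrDl; lra.
Qed.

Lemma cdiff_cexp (c k : R[i]) z : cdiff (fun z => cexp (c * z + k)) z.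
Proof.
set w := cexp (c * z + k).
have w1 : 0 < cabs w * (cabs c + 1) + 1 by rewrite ltr_wpDl// mulr_ge0 ?addr_ge0 ?cabs_ge0.
have c1 : 0 < cabs c + 1 by rewrite ltr_wpDl// cabs_ge0.
exists (w * c) => e e0.
have [r r0 rP] := cexp_first_order (divr_gt0 e0 w1).
exists (r / (cabs c + 1)) => [|h]; first exact: divr_gt0.
rewrite ltr_pdivlMr// => hr.
have ch : cabs (c * h) <= cabs h * (cabs c + 1).
  by rewrite cabsM mulrDr mulr1 mulrC lerDl cabs_ge0.
rewrite (_ : c * (z + h) + k = (c * z + k) + c * h); last by ring.
rewrite cexpD -/w (_ : _ - _ = w * (cexp (c * h) - 1 - c * h)); last by ring.
rewrite cabsM; apply: le_trans (ler_wpM2l (cabs_ge0 _) (rP _ (le_lt_trans ch hr))) _.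
apply: (@le_trans _ _ (cabs w * (e / (cabs w * (cabs c + 1) + 1) * (cabs h * (cabs c + 1))))).
  by rewrite ler_wpM2l ?cabs_ge0// ler_wpM2l// ltW// divr_gt0.
rewrite (_ : cabs w * _ = (e * cabs h) * ((cabs w * (cabs c + 1)) / (cabs w * (cabs c + 1) + 1))).
  rewrite ler_piMr ?mulr_ge0 ?cabs_ge0 ?(ltW e0)// ler_pdivrMr// mul1r lerDl//.
by field; rewrite gt_eqF.
Qed.

End ComplexExponential.

Section FockWeight.
Variable R : realType.
Local Notation mu := (@lebesgue_measure R).
Implicit Types f : R[i] -> R[i].

Definition plane (xy : R * R) : R[i] := xy.1 +i* xy.2.

Definition fock_weight f (z : R[i]) : R := cabs (f z) * expR (- (cabs z ^+ 2) / 2).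

Lemma fock_weight_ge0 f z : 0 <= fock_weight f z.
Proof. by rewrite mulr_ge0 ?cabs_ge0 ?expR_ge0. Qed.

Lemma fock_integralE nu f :
  fock_integral nu f = (\int[(mu \x mu)%E]_xy (fock_weight f (plane xy) `^ nu)%:E)%E.
Proof.
apply: eq_integral => xy _; congr EFin.
rewrite /fock_weight powRM ?cabs_ge0 ?expR_ge0// -expRM; congr (_ * expR _).
by rewrite /plane; field.
Qed.

Lemma measurable_plane_cabs f : (forall z, cdiff f z) ->
  measurable_fun setT (fun xy => cabs (f (plane xy))).
Proof.
move=> df; apply: continuous_plane_measurable => -[x y].
exact: cdiff_cabs_continuous.
Qed.

Lemma measurable_plane_sqdist (u : R[i]) :
  measurable_fun setT (fun xy => expR (- (cabs (plane xy - u) ^+ 2))).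
Proof.
apply: measurableT_comp => //; apply: measurableT_comp => //; apply: measurable_funX.
apply: (@measurable_plane_cabs (fun z => z - u)) => z.
have := cdiff_affine 1 (- u) z; congr (cdiff _ _).
by apply/funext => t; rewrite mul1r.
Qed.

Lemma measurable_fock_weight f nu : (forall z, cdiff f z) ->
  measurable_fun setT (fun xy => fock_weight f (plane xy) `^ nu).
Proof.
move=> df; apply: (measurableT_comp (measurable_powR nu)).
apply: measurable_funM; first exact: measurable_plane_cabs.
apply: measurableT_comp => //; apply: measurable_funM => //; apply: measurableT_comp => //.
apply: measurable_funX; apply: (@measurable_plane_cabs id) => z.
have := cdiff_affine 1 0 z; congr (cdiff _ _).
by apply/funext => t; rewrite mul1r addr0.
Qed.

Lemma integral_plane_gauss (k p q : R) : 0 < k ->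
  (\int[(mu \x mu)%E]_xy (expR (- (k * ((xy.1 - p) ^+ 2 + (xy.2 - q) ^+ 2))))%:E)%E = (pi / k)%:E.
Proof.
move=> k0; rewrite (fubini_tonelli1 (m1 := mu) (m2 := mu)) /=.
- rewrite /fubini_F /=.
  have E x : (\int[mu]_y (expR (- (k * ((x - p) ^+ 2 + (y - q) ^+ 2))))%:E =
      (Num.sqrt (pi / k))%:E * (expR (- (k * (x - p) ^+ 2)))%:E)%E.
    under eq_integral do rewrite mulrDr opprD expRD EFinM.
    rewrite ge0_integralZl//=.
    + by rewrite integral_gauss// muleC.
    + apply/measurable_EFinP; apply: measurableT_comp => //; apply: measurableT_comp => //.
      by apply: measurable_funM => //; apply: measurable_funX; apply: measurable_funB.
  under eq_integral do rewrite E.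
  rewrite ge0_integralZl//=.
  + rewrite integral_gauss// -EFinM -expr2 sqr_sqrtr// ltW// divr_gt0 ?pi_gt0//.
  + apply/measurable_EFinP; apply: measurableT_comp => //; apply: measurableT_comp => //.
    by apply: measurable_funM => //; apply: measurable_funX; apply: measurable_funB.
- apply/measurable_EFinP; apply: measurableT_comp => //; apply: measurableT_comp => //.
  apply: measurable_funM => //; apply: measurable_funD; apply: measurable_funX;
    by apply: measurable_funB.
- by move=> xy; rewrite lee_fin expR_ge0.
Qed.

End FockWeight.

(** * Sub-mean-value property of the Fock weight *)

Section SubMeanValue.
Variable R : realType.
Local Notation mu := (@lebesgue_measure R).

Lemma powR_pred (x nu : R) : 0 < x -> x `^ nu = x * x `^ (nu - 1).
Proof.
move=> x0; have := @powRD _ x 1 (nu - 1).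
by rewrite [1 + _]addrC subrK powRr1 ?(ltW x0)// => -> //; rewrite (gt_eqF x0) implybT.
Qed.

(** Above the level [l] one has x <= x (x / l)^(nu - 1). This replaces Jensen's inequality in
    passing from a first-power mean to a nu-th-power mean: with [l] a small multiple of the value to
    be estimated, the first summand can be absorbed on the left. *)
Lemma young_split (x l nu : R) : 0 <= x -> 0 < l -> 1 <= nu -> x <= l + x `^ nu * l `^ (1 - nu).
Proof.
move=> x0 l0 nu1; have [xl|lx] := leP x l.
  by rewrite (le_trans xl)// lerDl mulr_ge0 ?powR_ge0.
have xp : 0 < x by apply: lt_trans lx.
have -> : x `^ nu * l `^ (1 - nu) = x * (x / l) `^ (nu - 1).
  rewrite powRM ?(ltW xp) ?invr_ge0 ?(ltW l0)// mulrA -powR_pred//.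
  by rewrite -powR_inv1 ?(ltW l0)// -powRrM mulN1r opprB.
apply: (@le_trans _ _ (x * (x / l) `^ (nu - 1))); last by rewrite lerDr ltW.
rewrite ler_peMr ?(ltW xp)//.
have r1 : 1 <= x / l by rewrite ler_pdivlMr// mul1r ltW.
by have := @ler_powR _ _ r1 0 (nu - 1); rewrite powRr0 subr_ge0; apply.
Qed.

(* Multiplying f by this exponential centres the weight at u. *)
Let centre (f : R[i] -> R[i]) (u z : R[i]) := f z * cexp (- u^* * z + (cabs u ^+ 2 / 2)%:C).

Let cabs_centre f u z : cabs (centre f u z) = fock_weight f z * expR (cabs (z - u) ^+ 2 / 2).
Proof.
rewrite /centre cabsM cabs_cexp /fock_weight -mulrA -expRD; congr (_ * expR _).
rewrite !sqr_cabs; case: z u => [x y] [p q] /=; by field.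
Qed.

Lemma fock_weight_submean (nu : R) : 1 <= nu -> exists2 C : R, 0 < C &
  forall (f : R[i] -> R[i]) (u : R[i]), (forall z, cdiff f z) ->
  ((fock_weight f u `^ nu)%:E <= C%:E *
    \int[(mu \x mu)%E]_xy (fock_weight f (plane xy) `^ nu * expR (- (cabs (plane xy - u) ^+ 2)))%:E)%E.
Proof.
move=> nu1; have nu0 : 0 < nu by apply: lt_le_trans nu1.
(* With l = m / k, the contribution of the constant level, 8 (expR 2) l pi, is exactly m / 2.
   Absorbing it doubles the 8 of the area estimate, whence the 16 in [A]. *)
set k : R := 16 * expR 2 * pi.
have k0 : 0 < k by rewrite !mulr_gt0 ?expR_gt0 ?pi_gt0.
set A : R := 16 * (expR 1 `^ nu * expR 2).
have A0 : 0 < A by rewrite !mulr_gt0 ?powR_gt0 ?expR_gt0.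
exists (A * k `^ (nu - 1)); first by rewrite mulr_gt0 ?powR_gt0.
move=> f u df.
set J := (\int[_]_xy _)%E.
have mg := measurable_plane_sqdist u.
have mG := measurable_fock_weight nu df.
have J0 : (0 <= J)%E.
  by apply: integral_ge0 => xy _; rewrite lee_fin mulr_ge0 ?powR_ge0 ?expR_ge0.
have [m0|m0] := eqVneq (fock_weight f u) 0.
  by rewrite m0 powR0 ?gt_eqF// mule_ge0// lee_fin mulr_ge0 ?powR_ge0 ?(ltW A0).
have {}m0 : 0 < fock_weight f u by rewrite lt_neqAle eq_sym m0 fock_weight_ge0.
set m := fock_weight f u in m0 *.
set l := m / k; have l0 : 0 < l by rewrite divr_gt0.
pose g xy := expR (- (cabs (plane xy - u) ^+ 2)).
(* On the square of half-side 1 one has |z - u|^2 <= 2. So expR 2 * g >= 1 there, and centring costs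
   at most expR 1; multiplying by [g] makes the majorant integrable over the whole plane. *)
pose H xy : R := expR 2 * l * g xy +
  (expR 2 * expR 1 `^ nu * l `^ (1 - nu)) * (fock_weight f (plane xy) `^ nu * g xy).
have g0 xy : 0 <= g xy by exact: expR_ge0.
have mH : measurable_fun setT H.
  by apply: measurable_funD; apply: measurable_funM => //; apply: measurable_funM.
have c0 : 0 <= expR 2 * expR 1 `^ nu * l `^ (1 - nu) by rewrite !mulr_ge0 ?expR_ge0 ?powR_ge0.
have H0 xy : 0 <= H xy.
  apply: addr_ge0; apply: mulr_ge0 => //; first by rewrite mulr_ge0 ?expR_ge0 ?(ltW l0).
  by rewrite mulr_ge0 ?powR_ge0.
have dF z : cdiff (centre f u) z.
  by apply: cdiffM => //; exact: cdiff_cexp.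
have FH x y : `|x - Re u| <= 1 -> `|y - Im u| <= 1 -> cabs (centre f u (x +i* y)) <= H (x, y).
  move=> hx hy.
  have d2 : cabs (plane (x, y) - u) ^+ 2 <= 2.
    have sq (t : R) : `|t| <= 1 -> t ^+ 2 <= 1.
      by move=> t1; rewrite -real_normK ?num_real// exprn_ile1.
    rewrite sqr_cabs ReD ImD ReN ImN /plane /=; have := sq _ hx; have := sq _ hy; lra.
  have eg : 1 <= expR 2 * g (x, y).
    by rewrite /g -expRD -[X in X <= _]expR0 ler_expR subr_ge0.
  have cF : cabs (centre f u (x +i* y)) <= expR 1 * fock_weight f (plane (x, y)).
    rewrite cabs_centre mulrC ler_wpM2r ?fock_weight_ge0// ler_expR.
    by rewrite ler_pdivrMr// mul1r.
  apply: le_trans (young_split (cabs_ge0 _) l0 nu1) _.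
  apply: (@le_trans _ _ (l + expR 1 `^ nu * fock_weight f (plane (x, y)) `^ nu * l `^ (1 - nu))).
    rewrite lerD2l ler_wpM2r ?powR_ge0//.
    rewrite -powRM ?expR_ge0 ?fock_weight_ge0//.
    by apply: ge0_ler_powR; rewrite ?nnegrE ?cabs_ge0 ?(ltW nu0)// mulr_ge0 ?expR_ge0 ?fock_weight_ge0.
  have -> : H (x, y) = (expR 2 * g (x, y)) *
      (l + expR 1 `^ nu * fock_weight f (plane (x, y)) `^ nu * l `^ (1 - nu)).
    by rewrite /H; ring.
  by rewrite ler_peMl// addr_ge0 ?(ltW l0)// !mulr_ge0 ?powR_ge0.
have := cauchy_area_estimate dF mH H0 FH.
rewrite cabs_centre subrr cabs0 expr0n mul0r expR0 mulr1 -/m.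
have -> : (\int[(mu \x mu)%E]_xy (H xy)%:E =
    (expR 2 * l * pi)%:E + (expR 2 * expR 1 `^ nu * l `^ (1 - nu))%:E * J)%E.
  under eq_integral do rewrite /H EFinD EFinM [X in (_ + X)%E]EFinM.
  rewrite ge0_integralD//=; last first.
  - by apply/measurable_EFinP; apply: measurable_funM => //; apply: measurable_funM.
  - by move=> xy _; rewrite -EFinM lee_fin mulr_ge0 ?mulr_ge0 ?powR_ge0.
  - by apply/measurable_EFinP; apply: measurable_funM.
  - move=> xy _; rewrite -EFinM lee_fin; apply: mulr_ge0 => //; by rewrite mulr_ge0 ?expR_ge0 ?(ltW l0).
  congr (_ + _)%E.
    rewrite ge0_integralZl//=; last first.
    - by rewrite lee_fin mulr_ge0 ?expR_ge0 ?(ltW l0).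
    - by move=> xy _; rewrite lee_fin.
    - exact/measurable_EFinP.
    have := @integral_plane_gauss R 1 (Re u) (Im u) ltr01; rewrite divr1 => gI; rewrite [RHS]EFinM -gI.
    congr (_ * _)%E; apply: eq_integral => xy _; congr (expR (- _))%:E.
    by rewrite mul1r sqr_cabs ReD ImD ReN ImN.
  rewrite ge0_integralZl//=.
  - by apply/measurable_EFinP; apply: measurable_funM.
  - by move=> xy _; rewrite lee_fin mulr_ge0 ?powR_ge0.
case: J J0 => [j|_ _|//]; last first.
  by rewrite mulry gtr0_sg ?mul1e ?leey// mulr_gt0 ?powR_gt0.
rewrite !lee_fin => j0 main.
have E1 : 8 * (expR 2 * l * pi) = m / 2.
  have e2 : expR 2 != 0 :> R by rewrite gt_eqF ?expR_gt0.
  have p0 : pi != 0 :> R by rewrite gt_eqF ?pi_gt0.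
  by rewrite /l /k; move: (expR 2) (pi : R) e2 p0 => E P e2 p0; field; rewrite e2 p0.
have main2 : m <= A * l `^ (1 - nu) * j.
  rewrite /A; move: main; rewrite mulrDr E1; lra.
rewrite (powR_pred nu m0).
have -> : A * k `^ (nu - 1) * j = A * l `^ (1 - nu) * j * m `^ (nu - 1).
  rewrite /l powRM ?(ltW m0) ?invr_ge0 ?(ltW k0)//.
  rewrite -(powR_inv1 (ltW k0)) -powRrM mulN1r opprB.
  have -> : m `^ (1 - nu) = (m `^ (nu - 1))^-1 by rewrite -powRN opprB.
  by field; rewrite gt_eqF ?powR_gt0.
by rewrite ler_wpM2r ?powR_ge0.
Qed.

End SubMeanValue.

(** * Tonelli on pairs of planes and the composition estimate *)

Lemma ge0_integralZl_real d (T : measurableType d) (R : realType)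
    (m : {measure set T -> \bar R}) (f : T -> R) (k : R) :
  measurable_fun setT f -> (forall x, 0 <= f x) -> 0 <= k ->
  (k%:E * \int[m]_x (f x)%:E = \int[m]_x (k * f x)%:E)%E.
Proof.
move=> mf f0 k0; rewrite -ge0_integralZl ?lee_fin//; first exact/measurable_EFinP.
by move=> x _; rewrite lee_fin.
Qed.

(* In the library the sigma-finite structure of [m1 \x m2] is shadowed by the
   one for products of subprobabilities, so it is attached here to an alias. *)
Definition plane_measure (R : realType) :
    set (measurableTypeR R * measurableTypeR R)%type -> \bar R :=
  (@lebesgue_measure R \x @lebesgue_measure R)%E.

HB.instance Definition _ (R : realType) := Measure.on (@plane_measure R).

Lemma plane_measure_sigma_finite (R : realType) : sigma_finite setT (@plane_measure R).
Proof.
pose F n : set R := `[- n%:R, n%:R]%classic.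
exists (fun n => F n `*` F n).
  apply/esym; rewrite -subTset => -[x y] _.
  pose k := maxn (Num.bound `|x|) (Num.bound `|y|).
  have b (z : R) : (Num.bound `|z| <= k)%N -> F k z.
    move=> zk; rewrite /F /= in_itv /= -ler_norml (le_trans (ltW (archi_boundP (normr_ge0 z))))//.
    by rewrite ler_nat.
  by exists k => //; split; apply: b; rewrite ?leq_maxl ?leq_maxr.
move=> n; split; first by apply: measurableX; exact: measurable_itv.
have Fn : (@lebesgue_measure R (F n) < +oo)%E.
  by rewrite /F lebesgue_measure_itv /=; case: ifPn => _; rewrite -?EFinB ltry.
rewrite /plane_measure product_measure1E; [|exact: measurable_itv|exact: measurable_itv].
by apply: lte_mul_pinfty => //; rewrite ge0_fin_numE.
Qed.

HB.instance Definition _ (R : realType) :=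
  Measure_isSigmaFinite.Build _ _ _ (@plane_measure R) (@plane_measure_sigma_finite R).

Section CompositionEstimate.
Variable R : realType.
Local Notation mu := (@lebesgue_measure R).
Local Notation mu2 := ((@lebesgue_measure R) \x (@lebesgue_measure R))%E.

(** For fixed [y] the ridge is a Gaussian in [x] centred at [m]. The x-part of the isotropic
    Gaussian is bounded by 1, and its y-part is kept for the outer integral. *)
Lemma integral_ridge_gauss (e c1 c2 p q k s t : R) : 0 < e -> 0 < k -> c1 != 0 ->
  forall y, (\int[mu]_x (expR (- (e * (c1 * (x - p) + c2 * (y - q)) ^+ 2)) *
      expR (- (k * ((x - s) ^+ 2 + (y - t) ^+ 2))))%:E <=
    (Num.sqrt (pi / (e * c1 ^+ 2)))%:E * (expR (- (k * (y - t) ^+ 2)))%:E)%E.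
Proof.
move=> e0 k0 c10 y.
have ec0 : 0 < e * c1 ^+ 2 by rewrite mulr_gt0// exprn_even_gt0.
pose m := p - c2 * (y - q) / c1.
have mg (a b : R) : measurable_fun setT (fun x : R => expR (- (a * (x - b) ^+ 2))).
  apply: measurableT_comp => //; apply: measurableT_comp => //; apply: measurable_funM => //.
  by apply: measurable_funX; apply: measurable_funB.
rewrite -(integral_gauss m ec0) muleC ge0_integralZl_real ?expR_ge0//; last exact: mg.
apply: ge0_le_integral => //.
- apply/measurable_EFinP; apply: measurable_funM.
    apply: measurableT_comp => //; apply: measurableT_comp => //; apply: measurable_funM => //.
    apply: measurable_funX; apply: measurable_funD => //; apply: measurable_funM => //.
    exact: measurable_funB.
  apply: measurableT_comp => //; apply: measurableT_comp => //; apply: measurable_funM => //.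
  by apply: measurable_funD => //; apply: measurable_funX; apply: measurable_funB.
- by apply/measurable_EFinP; apply: measurable_funM => //; exact: mg.
move=> x _; rewrite lee_fin [leRHS]mulrC; apply: ler_pM; rewrite ?expR_ge0// ler_expR lerN2.
  rewrite -mulrA ler_pM2l// -exprMn (_ : c1 * (x - m) = c1 * (x - p) + c2 * (y - q))//.
  by rewrite /m; field.
by rewrite ler_pM2l// lerDr sqr_ge0.
Qed.

Let integral_ridge_case1 (e c1 c2 p q k s t : R) : 0 < e -> 0 < k -> c1 != 0 ->
  (\int[mu]_y \int[mu]_x (expR (- (e * (c1 * (x - p) + c2 * (y - q)) ^+ 2)) *
      expR (- (k * ((x - s) ^+ 2 + (y - t) ^+ 2))))%:E <=
    (Num.sqrt (pi / (e * c1 ^+ 2)) * Num.sqrt (pi / k))%:E)%E.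
Proof.
move=> e0 k0 c10.
have mg (a b : R) : measurable_fun setT (fun x : R => expR (- (a * (x - b) ^+ 2))).
  apply: measurableT_comp => //; apply: measurableT_comp => //; apply: measurable_funM => //.
  by apply: measurable_funX; apply: measurable_funB.
rewrite EFinM -(integral_gauss t k0) ge0_integralZl_real ?sqrtr_ge0//; last exact: mg.
apply: ge0_le_integral => //.
- by move=> y _; apply: integral_ge0 => x _; rewrite lee_fin mulr_ge0 ?expR_ge0.
- pose F (yx : R * R) := (expR (- (e * (c1 * (yx.2 - p) + c2 * (yx.1 - q)) ^+ 2)) *
      expR (- (k * ((yx.2 - s) ^+ 2 + (yx.1 - t) ^+ 2))))%:E.
  have mF : measurable_fun setT F.
    apply/measurable_EFinP; apply: measurable_funM.
      apply: measurableT_comp => //; apply: measurableT_comp => //; apply: measurable_funM => //.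
      apply: measurable_funX; apply: measurable_funD => //; apply: measurable_funM => //;
      exact: measurable_funB.
    apply: measurableT_comp => //; apply: measurableT_comp => //; apply: measurable_funM => //.
    by apply: measurable_funD => //; apply: measurable_funX; apply: measurable_funB.
  have F0 yx : (0 <= F yx)%E by rewrite lee_fin mulr_ge0 ?expR_ge0.
  exact: (measurable_fun_fubini_tonelli_F (m2 := mu) _ mF F0).
- by apply/measurable_EFinP; apply: measurable_funM => //; exact: mg.
by move=> y _; rewrite EFinM; exact: integral_ridge_gauss.
Qed.

(** [K] depends on the ridge only. The gain is in the power of k: k^(-1/2) instead of the 1/k of the
    isotropic Gaussian alone, because the ridge already confines one direction. *)
Lemma integral_plane_ridge (e c1 c2 : R) : 0 < e -> c1 != 0 \/ c2 != 0 -> exists2 K : R, 0 < K &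
  forall p q k s t, 0 < k ->
  (\int[mu2]_xy (expR (- (e * (c1 * (xy.1 - p) + c2 * (xy.2 - q)) ^+ 2)) *
      expR (- (k * ((xy.1 - s) ^+ 2 + (xy.2 - t) ^+ 2))))%:E <=
    (K * Num.sqrt (pi / k))%:E)%E.
Proof.
move=> e0 c12.
have mI p q k s t : measurable_fun setT (fun xy : R * R =>
    (expR (- (e * (c1 * (xy.1 - p) + c2 * (xy.2 - q)) ^+ 2)) *
      expR (- (k * ((xy.1 - s) ^+ 2 + (xy.2 - t) ^+ 2))))%:E).
  apply/measurable_EFinP; apply: measurable_funM.
    apply: measurableT_comp => //; apply: measurableT_comp => //; apply: measurable_funM => //.
    apply: measurable_funX; apply: measurable_funD => //; apply: measurable_funM => //;
    exact: measurable_funB.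
  apply: measurableT_comp => //; apply: measurableT_comp => //; apply: measurable_funM => //.
  by apply: measurable_funD => //; apply: measurable_funX; apply: measurable_funB.
have I0 p q k s t (xy : R * R) : (0 <= (expR (- (e * (c1 * (xy.1 - p) + c2 * (xy.2 - q)) ^+ 2)) *
      expR (- (k * ((xy.1 - s) ^+ 2 + (xy.2 - t) ^+ 2))))%:E)%E.
  by rewrite lee_fin mulr_ge0 ?expR_ge0.
case: c12 => c0.
- exists (Num.sqrt (pi / (e * c1 ^+ 2))).
    by rewrite sqrtr_gt0 divr_gt0 ?pi_gt0// mulr_gt0// exprn_even_gt0.
  move=> p q k s t k0; rewrite (fubini_tonelli2 (m1 := mu) (m2 := mu) _ (mI _ _ _ _ _) (I0 _ _ _ _ _)).
  exact: integral_ridge_case1.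
- exists (Num.sqrt (pi / (e * c2 ^+ 2))).
    by rewrite sqrtr_gt0 divr_gt0 ?pi_gt0// mulr_gt0// exprn_even_gt0.
  move=> p q k s t k0; rewrite (fubini_tonelli1 (m1 := mu) (m2 := mu) _ (mI _ _ _ _ _) (I0 _ _ _ _ _)).
  apply: le_trans (@integral_ridge_case1 e c2 c1 q p k t s e0 k0 c0).
  rewrite le_eqVlt; apply/orP; left; apply/eqP.
  by apply: eq_integral => x _; apply: eq_integral => y _; congr (expR (- (_ * _ ^+ 2)) * expR (- (_ * _)))%:E; rewrite addrC.
Qed.

Let affine_plane (al be : R[i]) (xy : R * R) : R * R :=
  (Re (al * plane xy + be), Im (al * plane xy + be)).

Let measurable_affine_plane al be : measurable_fun setT (affine_plane al be).
Proof.
apply: measurable_fun_pair; rewrite /plane /=.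
  apply: (@eq_measurable_fun _ _ _ _ setT (fun xy : R * R => Re al * xy.1 - Im al * xy.2 + Re be)).
    by move=> xy _; rewrite ReD ReM.
  apply: measurable_funD => //; apply: measurable_funB; exact: measurable_funM.
apply: (@eq_measurable_fun _ _ _ _ setT (fun xy : R * R => Re al * xy.2 + Im al * xy.1 + Im be)).
  by move=> xy _; rewrite ImD ImM.
apply: measurable_funD => //; apply: measurable_funD; exact: measurable_funM.
Qed.

Let plane_affine al be xy : plane (affine_plane al be xy) = al * plane xy + be.
Proof. by rewrite /affine_plane /plane; case: (_ + _). Qed.

Lemma measurable_fock_weight_affine (nu : R) f (al be : R[i]) : (forall z, cdiff f z) ->
  measurable_fun setT (fun xy => fock_weight f (al * plane xy + be) `^ nu).
Proof.
move=> df.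
apply: (@eq_measurable_fun _ _ _ _ setT
    ((fun xy => fock_weight f (plane xy) `^ nu) \o affine_plane al be)).
  by move=> xy _; rewrite /= plane_affine.
exact: (measurableT_comp (measurable_fock_weight nu df) (measurable_affine_plane al be)).
Qed.

(** The weight at al z + be is replaced by its Gaussian mean over v and the integrals are exchanged.
    For fixed v the inner integrand is the ridge times a Gaussian in z with k = |al|^2, so the cost
    is 1/|al| rather than the 1/|al|^2 of a change of variables. *)
Lemma fock_comp_estimate (nu e c1 c2 : R) : 1 <= nu -> 0 < e -> c1 != 0 \/ c2 != 0 ->
  exists2 K : R, 0 < K &
  forall f (al be : R[i]) (p q : R), (forall z, cdiff f z) -> al != 0 ->
  (\int[mu2]_xy (expR (- (e * (c1 * (xy.1 - p) + c2 * (xy.2 - q)) ^+ 2)) *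
      fock_weight f (al * plane xy + be) `^ nu)%:E <= (K / cabs al)%:E * fock_integral nu f)%E.
Proof.
move=> nu1 e0 c12.
have [C C0 sub] := fock_weight_submean nu1.
have [K K0 ridge] := integral_plane_ridge e0 c12.
exists (C * K * Num.sqrt pi); first by rewrite !mulr_gt0// sqrtr_gt0 pi_gt0.
move=> f al be p q df al0.
have cal0 : 0 < cabs al by rewrite cabs_gt0.
pose E (xy : R * R) := expR (- (e * (c1 * (xy.1 - p) + c2 * (xy.2 - q)) ^+ 2)).
pose g (zv : (R * R) * (R * R)) := expR (- (cabs (plane zv.2 - (al * plane zv.1 + be)) ^+ 2)).
pose W (v : R * R) := fock_weight f (plane v) `^ nu.
have W0 v : 0 <= W v by exact: powR_ge0.
have E0 v : 0 <= E v by exact: expR_ge0.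
have g0 v : 0 <= g v by exact: expR_ge0.
have mE : measurable_fun setT E.
  apply: measurableT_comp => //; apply: measurableT_comp => //; apply: measurable_funM => //.
  apply: measurable_funX; apply: measurable_funD => //; apply: measurable_funM => //;
  exact: measurable_funB.
have mW : measurable_fun setT W by exact: measurable_fock_weight.
have mWa := measurable_fock_weight_affine nu al be df.
have mg : measurable_fun setT g.
  apply: (@eq_measurable_fun _ _ _ _ setT (fun zv : (R * R) * (R * R) =>
    expR (- ((zv.2.1 - (affine_plane al be zv.1).1) ^+ 2 + (zv.2.2 - (affine_plane al be zv.1).2) ^+ 2)))).
    by move=> zv _; rewrite /g sqr_cabs ReD ImD ReN ImN.
  have m2 : measurable_fun setT (fun zv : (R * R) * (R * R) => affine_plane al be zv.1).
    exact: (measurableT_comp (measurable_affine_plane al be)).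
  apply: measurableT_comp => //; apply: measurableT_comp => //; apply: measurable_funD;
    apply: measurable_funX; apply: measurable_funB.
  - exact: (measurableT_comp measurable_fst).
  - exact: (measurableT_comp measurable_fst).
  - exact: (measurableT_comp measurable_snd).
  - exact: (measurableT_comp measurable_snd).
pose Phi zv := (E zv.1 * (C * (W zv.2 * g zv)))%:E.
have mPhi : measurable_fun setT Phi.
  have mE1 : measurable_fun setT (fun zv : (R * R) * (R * R) => E zv.1).
    exact: (measurableT_comp mE measurable_fst).
  have mW2 : measurable_fun setT (fun zv : (R * R) * (R * R) => W zv.2).
    exact: (measurableT_comp mW measurable_snd).
  apply/measurable_EFinP; apply: (measurable_funM mE1).
  apply: measurable_funM; [exact: measurable_cst|exact: measurable_funM].
have Phi0 zv : (0 <= Phi zv)%E.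
  by rewrite lee_fin !mulr_ge0// ltW.
apply: (@le_trans _ _ (\int[mu2]_z \int[mu2]_v Phi (z, v))%E).
  apply: ge0_le_integral => //.
  - by move=> z _; rewrite lee_fin mulr_ge0 ?expR_ge0 ?powR_ge0.
  - by apply/measurable_EFinP; exact: (measurable_funM mE mWa).
  - exact: (measurable_fun_fubini_tonelli_F (m2 := @plane_measure R) Phi mPhi Phi0).
  move=> z _; rewrite EFinM.
  have mWg : measurable_fun setT (fun v => W v * g (z, v)).
    exact: (measurable_funM mW (measurable_fun_pair2 z mg)).
  have Wg0 v : 0 <= W v * g (z, v) by rewrite mulr_ge0.
  rewrite /Phi /= -(@ge0_integralZl_real _ _ _ mu2 (fun v => C * (W v * g (z, v)))); last first.
  - exact: E0.
  - by move=> v; rewrite mulr_ge0// ltW.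
  - exact: (measurable_funM (measurable_cst C) mWg).
  rewrite lee_pmul2l//; last by rewrite lte_fin expR_gt0.
  rewrite -(@ge0_integralZl_real _ _ _ mu2 _ C mWg Wg0 (ltW C0)).
  exact: sub.
have -> : (\int[mu2]_z \int[mu2]_v Phi (z, v) = \int[mu2]_v \int[mu2]_z Phi (z, v))%E.
  exact: (fubini_tonelli (m1 := @plane_measure R) (m2 := @plane_measure R) Phi mPhi Phi0).
have KC0 : 0 <= C * K * Num.sqrt pi / cabs al.
  by rewrite divr_ge0 ?(ltW cal0)// !mulr_ge0 ?sqrtr_ge0 ?(ltW C0) ?(ltW K0).
rewrite fock_integralE (@ge0_integralZl_real _ _ _ mu2 _ _ mW W0 KC0).
apply: ge0_le_integral => //.
- by move=> v _; apply: integral_ge0.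
- exact: (measurable_fun_fubini_tonelli_G (m1 := @plane_measure R) Phi mPhi Phi0).
- by apply/measurable_EFinP; exact: (measurable_funM (measurable_cst _) mW).
move=> v _.
(* The preimage of v under z -> al z + be, hence the centre of the Gaussian seen as a function of
   z. *)
pose zv := al^-1 * (plane v - be).
have gE z : g (z, v) = expR (- (cabs al ^+ 2 * ((z.1 - Re zv) ^+ 2 + (z.2 - Im zv) ^+ 2))).
  rewrite /g /=; congr expR; congr (- _).
  have -> : plane v - (al * plane z + be) = - (al * (plane z - zv)).
    by rewrite /zv; field.
  by rewrite cabsN cabsM exprMn [X in _ * X = _]sqr_cabs ReD ImD ReN ImN.
have -> : (\int[mu2]_z Phi (z, v) = (C * W v)%:E * \int[mu2]_z (E z * g (z, v))%:E)%E.
  have mEg := measurable_funM mE (measurable_fun_pair1 v mg).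
  have Eg0 z : 0 <= E z * g (z, v) by rewrite mulr_ge0.
  have CW0 : 0 <= C * W v by rewrite mulr_ge0// ltW.
  rewrite (@ge0_integralZl_real _ _ _ mu2 _ _ mEg Eg0 CW0).
  by apply: eq_integral => z _; rewrite /Phi /=; congr EFin; ring.
under eq_integral do rewrite gE.
have al2 : 0 < cabs al ^+ 2 by rewrite exprn_gt0.
have H := ridge p q _ (Re zv) (Im zv) al2.
apply: (@le_trans _ _ ((C * W v)%:E * (K * Num.sqrt (pi / cabs al ^+ 2))%:E)%E).
  by apply: lee_wpmul2l H; rewrite lee_fin mulr_ge0// ltW.
rewrite -EFinM lee_fin sqrtrM ?pi_ge0// sqrtrV ?(ltW al2)// sqrtr_sqr ger0_norm ?(ltW cal0)//.
by rewrite le_eqVlt; apply/orP; left; apply/eqP; rewrite /W; ring.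
Qed.

End CompositionEstimate.

(** * The quadratic exponent and its orbit sums *)

Section QuadraticExponent.
Variable R : realType.

Lemma sum_geometric_le (x : R) n : 0 <= x -> x < 1 -> \sum_(j < n) x ^+ j <= (1 - x)^-1.
Proof.
move=> x0 x1; have x1' : 0 < 1 - x by rewrite subr_gt0.
rewrite -(ler_pM2l x1') mulfV ?gt_eqF// -opprB mulNr -subrX1 opprB lerBlDr lerDl.
exact: exprn_ge0.
Qed.

Lemma linear_quadratic_le (k d t : R) : 0 < d -> k * t - d * t ^+ 2 <= k ^+ 2 / (4 * d).
Proof.
move=> d0; rewrite -subr_ge0.
rewrite (_ : _ - _ = d * (t - k / (2 * d)) ^+ 2); first by rewrite mulr_ge0 ?sqr_ge0// ltW.
by field; rewrite gt_eqF.
Qed.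

(** The polynomial S of the overview, with linear coefficient [L]; by [wexp_expand] it is the
    increment of the exponent at any base point whose slope is [L]. *)
Definition qexp (a r L z : R[i]) : R :=
  Re (L * z) + Re (r * z ^+ 2) - (1 - cabs a ^+ 2) / 2 * cabs z ^+ 2.

Lemma qexp_abs_le a r L z : cabs a <= 1 ->
  `|qexp a r L z| <= (cabs L + (cabs r + 1) * cabs z) * cabs z.
Proof.
move=> a1.
have k0 : 0 <= (1 - cabs a ^+ 2) / 2 by rewrite divr_ge0// subr_ge0 exprn_ile1 ?cabs_ge0.
have k1 : (1 - cabs a ^+ 2) / 2 <= 1 by have := sqr_ge0 (cabs a); lra.
rewrite (_ : _ * cabs z = cabs L * cabs z + cabs r * cabs z ^+ 2 + cabs z ^+ 2); last by ring.
apply: le_trans (ler_normB _ _) _; apply: lerD.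
  apply: le_trans (ler_normD _ _) _; apply: lerD; apply: le_trans (normr_Re_le _) _; rewrite cabsM//.
  by rewrite cabsX.
rewrite ger0_norm; last by rewrite mulr_ge0 ?sqr_ge0.
by rewrite ler_piMl ?sqr_ge0.
Qed.

Variables (a r L : R[i]).
Hypotheses (a1 : cabs a < 1) (r0 : 0 < cabs r) (ra : cabs r <= (1 - cabs a ^+ 2) / 2).
Hypothesis Sub : exists C : R, forall z, qexp a r L z <= C.

Let sg := sqrtc r.
Let eta (z : R[i]) : R := Im (sg * z).

Let sg2 : cabs sg ^+ 2 = cabs r.
Proof. by rewrite -cabsX sqr_sqrtc. Qed.

Let sg0 : sg != 0.
Proof. by rewrite -cabs_gt0 lt_neqAle cabs_ge0 andbT eq_sym -sqrf_eq0 sg2 gt_eqF. Qed.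

(** Re(r z^2) and |r||z|^2 are the difference and the sum of the squares of the real and imaginary
    parts of sqrt(r) z. *)
Let qexpE z : qexp a r L z =
  Re (L * z) - ((1 - cabs a ^+ 2) / 2 - cabs r) * cabs z ^+ 2 - 2 * eta z ^+ 2.
Proof.
have E1 : Re (r * z ^+ 2) = Re (sg * z) ^+ 2 - eta z ^+ 2.
  rewrite -[r]sqr_sqrtc -/sg -exprMn expr2 ReM /eta; ring.
have E2 : cabs r * cabs z ^+ 2 = Re (sg * z) ^+ 2 + eta z ^+ 2.
  by rewrite -sg2 -exprMn -cabsM sqr_cabs.
have E3 : Re (sg * z) ^+ 2 = cabs r * cabs z ^+ 2 - eta z ^+ 2 by rewrite E2; ring.
by rewrite /qexp E1 E3; ring.
Qed.

Definition qexp_sum n z := \sum_(j < n) qexp a r L (a ^+ j * z).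

Let Re_sum_le n z : \sum_(j < n) Re (L * (a ^+ j * z)) <= cabs L / (1 - cabs a) * cabs z.
Proof.
have -> : cabs L / (1 - cabs a) * cabs z = cabs L * cabs z * (1 - cabs a)^-1 by ring.
apply: (@le_trans _ _ (\sum_(j < n) cabs L * cabs z * cabs a ^+ j)).
  apply: ler_sum => j _; apply: le_trans (ler_norm _) _; apply: le_trans (normr_Re_le _) _.
  by rewrite !cabsM cabsX -mulrA [X in _ * X]mulrC.
by rewrite -mulr_sumr ler_wpM2l ?mulr_ge0 ?cabs_ge0// sum_geometric_le ?cabs_ge0.
Qed.

Let term_le z : qexp a r L z <= Re (L * z) - 2 * eta z ^+ 2.
Proof.
rewrite qexpE lerD2r lerBlDr lerDl mulr_ge0 ?sqr_ge0// subr_ge0; exact: ra.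
Qed.

Let term_le' z : qexp a r L z <= Re (L * z).
Proof. by apply: le_trans (term_le z) _; rewrite lerBlDr lerDl mulr_ge0 ?sqr_ge0. Qed.

(* At equality boundedness of the exponent along the null line of eta forces the
   linear part to be a multiple of eta. *)
Let linear_part : cabs r = (1 - cabs a ^+ 2) / 2 -> exists k, forall z, Re (L * z) = k * eta z.
Proof.
move=> rE; have [C HC] := Sub.
have E t : qexp a r L (t%:C / sg) = t * Re (L / sg).
  rewrite qexpE -rE subrr mul0r subr0.
  have -> : eta (t%:C / sg) = 0 by rewrite /eta mulrCA mulfV// mulr1.
  have -> : L * (t%:C / sg) = t%:C * (L / sg) by rewrite mulrCA.
  by rewrite expr0n mulr0 subr0 (ReM t%:C) [Re t%:C]/= [Im t%:C]/= mul0r subr0.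
have L0 : Re (L / sg) = 0.
  apply/eqP; apply: contrapT => /negP n0.
  have := HC (((`|C| + 1) / Re (L / sg))%:C / sg); rewrite E divfK//.
  by have := ler_norm C; lra.
exists (- Im (L / sg)) => z.
have -> : L * z = (L / sg) * (sg * z) by field.
by rewrite ReM L0 mul0r sub0r mulNr.
Qed.

(** The term j = 0 supplies -2 eta^2, hence 0 < n. One copy of eta^2 is kept for the conclusion; the
    other must help absorb the linear terms, whose sum is controlled by a geometric series. *)
Lemma qexp_sum_le : exists C, forall n z, (0 < n)%N ->
  qexp_sum n z <= C - (Im sg * Re z + Re sg * Im z) ^+ 2.
Proof.
have etaE z : Im sg * Re z + Re sg * Im z = eta z by rewrite /eta ImM addrC.
set K := cabs L / (1 - cabs a).
set d := (1 - cabs a ^+ 2) / 2 - cabs r.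
(* Strict inequality: the definite part -d |z|^2 of the term j = 0 absorbs all linear terms. *)
have [d0|d0] := ltP 0 d.
  exists (K ^+ 2 / (4 * d)) => -[//|n] z _; rewrite etaE.
  have : qexp_sum n.+1 z <= K * cabs z - d * cabs z ^+ 2 - 2 * eta z ^+ 2.
    apply: (@le_trans _ _ (\sum_(j < n.+1) Re (L * (a ^+ j * z)) - d * cabs z ^+ 2 - 2 * eta z ^+ 2)).
      rewrite /qexp_sum !big_ord_recl /= expr0 mul1r qexpE -/d.
      have : \sum_(i < n) qexp a r L (a ^+ lift ord0 i * z) <= \sum_(i < n) Re (L * (a ^+ lift ord0 i * z)).
        by apply: ler_sum => j _; exact: term_le'.
      lra.
    by rewrite !lerD2r; exact: Re_sum_le.
  have := linear_quadratic_le K (cabs z) d0; have := sqr_ge0 (eta z); lra.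
have rE : cabs r = (1 - cabs a ^+ 2) / 2 by have := ra; move: d0; rewrite /d; lra.
have [k kE] := linear_part rE.
(* Equality with [a] real: eta(a^j z) = a^j eta(z), so all linear terms are controlled by |eta(z)|
   and the spare eta^2 absorbs them. *)
have [ia0|ia0] := eqVneq (Im a) 0.
  have aR : a = (Re a)%:C by apply: complex_ext.
  have aX j : a ^+ j = (Re a ^+ j)%:C by rewrite {1}aR -rmorphXn.
  have Ra : `|Re a| < 1 by apply: le_lt_trans (normr_Re_le a) _; exact: a1.
  have Ra0 : 0 < 1 - `|Re a| by rewrite subr_gt0.
  pose k' := `|k| / (1 - `|Re a|).
  exists (k' ^+ 2 / (4 * 1)) => -[//|n] z _; rewrite etaE.
  have : qexp_sum n.+1 z <= k' * `|eta z| - 2 * eta z ^+ 2.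
    apply: (@le_trans _ _ (\sum_(j < n.+1) Re (L * (a ^+ j * z)) - 2 * eta z ^+ 2)).
      rewrite /qexp_sum !big_ord_recl /= expr0 mul1r.
      have : \sum_(i < n) qexp a r L (a ^+ lift ord0 i * z) <= \sum_(i < n) Re (L * (a ^+ lift ord0 i * z)).
        by apply: ler_sum => j _; exact: term_le'.
      have := term_le z; lra.
    rewrite lerD2r (_ : k' * _ = `|k| * `|eta z| * (1 - `|Re a|)^-1); last by rewrite /k'; ring.
    apply: (@le_trans _ _ (\sum_(j < n.+1) `|k| * `|eta z| * `|Re a| ^+ j)).
      apply: ler_sum => j _; rewrite kE; apply: le_trans (ler_norm _) _.
      rewrite normrM -mulrA ler_wpM2l// /eta aX mulrCA ImM /= mul0r addr0 normrM mulrC.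
      by rewrite normrX.
    by rewrite -mulr_sumr ler_wpM2l ?mulr_ge0// sum_geometric_le.
  have := linear_quadratic_le k' `|eta z| ltr01; rewrite real_normK ?num_real//.
  have := sqr_ge0 (eta z); lra.
(* Equality with [a] not real: multiplication by [a] moves the null line of eta, so eta(z)^2 + 2
   eta(a z)^2 is positive definite, with lower bound [d1]. This uses the terms j = 0 and j = 1, so n
   = 1 is treated apart, by [linear_part] alone. *)
pose d1 := Im a ^+ 2 * cabs r / 3.
have d10 : 0 < d1 by rewrite divr_gt0// mulr_gt0// exprn_even_gt0.
exists (k ^+ 2 / (4 * 1) + K ^+ 2 / (4 * d1)) => -[//|[|n]] z _; rewrite etaE.
  rewrite /qexp_sum big_ord1 expr0 mul1r.
  have := term_le z; rewrite kE; have := linear_quadratic_le k (eta z) ltr01.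
  have : 0 <= K ^+ 2 / (4 * d1) by rewrite divr_ge0 ?sqr_ge0// mulr_ge0// ltW.
  lra.
have sumle : qexp_sum n.+2 z <= K * cabs z - 2 * eta z ^+ 2 - 2 * eta (a * z) ^+ 2.
  apply: (@le_trans _ _ (\sum_(j < n.+2) Re (L * (a ^+ j * z)) - 2 * eta z ^+ 2 - 2 * eta (a * z) ^+ 2)).
    rewrite /qexp_sum !big_ord_recl /= expr0 mul1r expr1.
    have : \sum_(i < n) qexp a r L (a ^+ lift ord0 (lift ord0 i) * z) <=
        \sum_(i < n) Re (L * (a ^+ lift ord0 (lift ord0 i) * z)).
      by apply: ler_sum => j _; exact: term_le'.
    have := term_le z; have := term_le (a * z); lra.
  by rewrite !lerD2r; exact: Re_sum_le.
have pos : d1 * cabs z ^+ 2 <= eta z ^+ 2 + 2 * eta (a * z) ^+ 2.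
  have E2 : cabs r * cabs z ^+ 2 = Re (sg * z) ^+ 2 + eta z ^+ 2.
    by rewrite -sg2 -exprMn -cabsM sqr_cabs.
  rewrite /d1 (_ : _ * _ / 3 * _ = Im a ^+ 2 * (cabs r * cabs z ^+ 2) / 3); last by ring.
  rewrite E2.
  have -> : eta (a * z) = Re a * eta z + Im a * Re (sg * z).
    by rewrite /eta mulrCA ImM.
  have a2 : Re a ^+ 2 + Im a ^+ 2 <= 1.
    by rewrite -sqr_cabs exprn_ile1 ?cabs_ge0 ?ltW.
  set X := Re (sg * z); set Y := eta z; set U := Re a * Y + Im a * X.
  have H1 : (Im a * X) ^+ 2 <= 2 * U ^+ 2 + 2 * (Re a ^+ 2 * Y ^+ 2).
    have := sqr_ge0 (U + Re a * Y); rewrite /U => H.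
    rewrite -subr_ge0; apply: le_trans H _; rewrite -subr_ge0.
    rewrite (_ : _ - _ = 0)//; ring.
  have Y0 := sqr_ge0 Y.
  have H2 : Re a ^+ 2 * Y ^+ 2 <= Y ^+ 2 by rewrite ler_piMl//; have := sqr_ge0 (Im a); lra.
  have H3 : Im a ^+ 2 * Y ^+ 2 <= Y ^+ 2 by rewrite ler_piMl//; have := sqr_ge0 (Re a); lra.
  have U0 := sqr_ge0 U.
  rewrite mulrDr -exprMn; lra.
have := linear_quadratic_le K (cabs z) d10; have : 0 <= k ^+ 2 / (4 * 1) by rewrite divr_ge0 ?sqr_ge0.
lra.
Qed.

End QuadraticExponent.

(** * Norm comparisons and the exponential kernels *)

Section PowRScaling.
Variable R : realType.

Lemma powR_inv_scale_le (nu k M F G : R) : 0 < nu -> 0 <= k -> 0 <= M -> 0 <= F -> 0 <= G ->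
  G <= M * F -> (k * G) `^ nu^-1 <= M `^ nu^-1 * (k * F) `^ nu^-1.
Proof.
move=> nu0 k0 M0 F0 G0 H; rewrite -powRM//; last by rewrite mulr_ge0.
apply: ge0_ler_powR; first by rewrite invr_ge0 ltW.
- by rewrite nnegrE mulr_ge0.
- by rewrite nnegrE mulr_ge0// mulr_ge0.
by rewrite mulrCA ler_wpM2l.
Qed.

Lemma powR_inv_scale_ge (nu k m F : R) : 0 < nu -> 0 <= k -> 0 <= m -> 0 <= F ->
  m `^ nu <= F -> k `^ nu^-1 * m <= (k * F) `^ nu^-1.
Proof.
move=> nu0 k0 m0 F0 H.
have -> : m = (m `^ nu) `^ nu^-1 by rewrite -powRrM mulfV ?gt_eqF// powRr1.
rewrite -powRM ?powR_ge0//; apply: ge0_ler_powR; first by rewrite invr_ge0 ltW.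
- by rewrite nnegrE mulr_ge0// powR_ge0.
- by rewrite nnegrE mulr_ge0.
by rewrite ler_wpM2l.
Qed.

End PowRScaling.

Section FockTools.
Variable R : realType.
Local Notation mu2 := ((@lebesgue_measure R) \x (@lebesgue_measure R))%E.
Implicit Types f : R[i] -> R[i].

Lemma entire_cdiff f : entire f -> forall z, cdiff f z.
Proof. by move=> ef z; exact: derivable_cdiff. Qed.

Lemma fock_integral_ge0 nu f : (0 <= fock_integral nu f)%E.
Proof. by rewrite fock_integralE; apply: integral_ge0 => xy _; rewrite lee_fin powR_ge0. Qed.

Lemma fock_integral_fineK nu f : in_fock nu f -> ((fine (fock_integral nu f))%:E = fock_integral nu f)%E.
Proof. by move=> [_ fi]; rewrite fineK// ge0_fin_numE// fock_integral_ge0. Qed.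

Lemma fock_norm_le (nu M : R) f g : 0 < nu -> 0 <= M -> in_fock nu f -> in_fock nu g ->
  (fock_integral nu g <= M%:E * fock_integral nu f)%E ->
  fock_norm nu g <= M `^ nu^-1 * fock_norm nu f.
Proof.
move=> nu0 M0 hf hg; rewrite -(fock_integral_fineK hf) -(fock_integral_fineK hg) lee_fin => H.
have k0 : 0 <= nu / (2 * pi) by rewrite divr_ge0 ?(ltW nu0)// mulr_ge0// pi_ge0.
have If : 0 <= fine (fock_integral nu f) by rewrite fine_ge0// fock_integral_ge0.
have Ig : 0 <= fine (fock_integral nu g) by rewrite fine_ge0// fock_integral_ge0.
exact: powR_inv_scale_le nu0 k0 M0 If Ig H.
Qed.

(** The reproducing kernel of the Fock space with nu = 2. Its weight is a Gaussian bump centred at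
    [u], which makes its norm explicit for every nu. *)
Definition exp_kernel (u : R[i]) (z : R[i]) : R[i] := cexp (u^* * z).

Lemma fock_weight_exp_kernel u z :
  fock_weight (exp_kernel u) z = expR (cabs u ^+ 2 / 2) * expR (- (2^-1 * cabs (z - u) ^+ 2)).
Proof.
rewrite /fock_weight /exp_kernel cabs_cexp -!expRD; congr expR.
by rewrite !sqr_cabs; case: z u => [x y] [s t] /=; field.
Qed.

Lemma fock_integral_exp_kernel (nu : R) u : 0 < nu ->
  fock_integral nu (exp_kernel u) = ((expR (cabs u ^+ 2 / 2)) `^ nu * (2 * pi / nu))%:E.
Proof.
move=> nu0; have n2 : 0 < nu / 2 by rewrite divr_gt0.
rewrite fock_integralE.
have E xy : fock_weight (exp_kernel u) (plane xy) `^ nu = expR (cabs u ^+ 2 / 2) `^ nu *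
    expR (- (nu / 2 * ((xy.1 - Re u) ^+ 2 + (xy.2 - Im u) ^+ 2))).
  rewrite fock_weight_exp_kernel powRM ?expR_ge0// -[X in _ * X = _]expRM; congr (_ * expR _).
  by rewrite sqr_cabs ReD ImD ReN ImN /plane /=; ring.
under eq_integral do rewrite E.
rewrite -(@ge0_integralZl_real _ _ _ mu2 (fun xy => expR (- (nu / 2 * ((xy.1 - Re u) ^+ 2 + (xy.2 - Im u) ^+ 2))))).
- by rewrite integral_plane_gauss// -EFinM; congr (_ * _)%:E; field; rewrite gt_eqF.
- apply: measurableT_comp => //; apply: measurableT_comp => //; apply: measurable_funM => //.
  by apply: measurable_funD; apply: measurable_funX; apply: measurable_funB.
- by move=> xy; exact: expR_ge0.
- exact: powR_ge0.
Qed.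

Lemma in_fock_exp_kernel (nu : R) u : 0 < nu -> in_fock nu (exp_kernel u).
Proof.
move=> nu0.
have dK z : cdiff (exp_kernel u) z.
  rewrite (_ : exp_kernel u = fun z => cexp (u^* * z + 0)); first exact: cdiff_cexp.
  by apply/funext => t; rewrite addr0.
split; first exact: (fun z => cdiff_derivable (dK z)).
by rewrite fock_integral_exp_kernel// ltry.
Qed.

Lemma fock_norm_exp_kernel (nu : R) u : 0 < nu ->
  fock_norm nu (exp_kernel u) = expR (cabs u ^+ 2 / 2).
Proof.
move=> nu0; rewrite /fock_norm fock_integral_exp_kernel//=.
set E := expR _; have p0 : 0 < pi :> R by exact: pi_gt0.
rewrite (_ : _ * _ = E `^ nu).
  by rewrite -powRrM mulfV ?gt_eqF// powRr1// expR_ge0.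
by move: (E `^ nu) (pi : R) p0 => F P p0; field; rewrite !gt_eqF.
Qed.

(** The box has area one, so the integral over it is at least m^nu. This turns pointwise lower
    bounds into norm bounds without any mean-value argument. *)
Lemma fock_norm_ge (nu : R) f (x0 y0 m : R) : 0 < nu -> in_fock nu f -> 0 <= m ->
  (forall x y, x0 <= x <= x0 + 1 -> y0 <= y <= y0 + 1 -> m <= fock_weight f (x +i* y)) ->
  (nu / (2 * pi)) `^ nu^-1 * m <= fock_norm nu f.
Proof.
move=> nu0 hf m0 H.
have k0 : 0 <= nu / (2 * pi) by rewrite divr_ge0 ?(ltW nu0)// mulr_ge0// pi_ge0.
have I0 : 0 <= fine (fock_integral nu f) by rewrite fine_ge0// fock_integral_ge0.
suff Im : m `^ nu <= fine (fock_integral nu f).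
  exact: powR_inv_scale_ge nu0 k0 m0 I0 Im.
rewrite -lee_fin fock_integral_fineK// fock_integralE.
pose B : set (R * R) := `[x0, x0 + 1]%classic `*` `[y0, y0 + 1]%classic.
have mB : measurable B by apply: measurableX; exact: measurable_itv.
have mW := measurable_fock_weight nu (entire_cdiff hf.1).
apply: (@le_trans _ _ (\int[mu2]_(xy in B) (fock_weight f (plane xy) `^ nu)%:E)%E); last first.
  apply: ge0_subset_integral => //; first exact/measurable_EFinP.
  by move=> xy _; rewrite lee_fin powR_ge0.
have -> : (m `^ nu)%:E = (\int[mu2]_(xy in B) cst (m `^ nu)%:E xy)%E.
  have itv1 (c : R) : lebesgue_measure (`[c, c + 1]%classic : set R) = 1%E.
    by rewrite lebesgue_measure_itv /= lte_fin ltrDl ltr01 -EFinB addrAC subrr add0r.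
  have B1 : @plane_measure R B = 1%E.
    rewrite /plane_measure /B product_measure1E; [|exact: measurable_itv|exact: measurable_itv].
    by transitivity (1 * 1 : \bar R)%E; [congr (_ * _)%E; exact: itv1|rewrite mule1].
  rewrite integral_cst//; transitivity ((m `^ nu)%:E * 1)%E; first by rewrite mule1.
  by congr (_ * _)%E; exact/esym/B1.
apply: ge0_le_integral => //.
- by move=> xy _; rewrite lee_fin powR_ge0.
- by apply: measurable_funTS; exact/measurable_EFinP.
move=> [x y] [/=]; rewrite !in_itv /= => hx hy; rewrite lee_fin.
by apply: ge0_ler_powR; rewrite ?nnegrE ?fock_weight_ge0 ?(ltW nu0)//; exact: H.
Qed.

End FockTools.

(** * Iterates of the weighted composition operator *)

Section WeightedComposition.
Variable R : realType.
Local Notation mu2 := ((@lebesgue_measure R) \x (@lebesgue_measure R))%E.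
Variables a b p q r : R[i].

Let phi z := a * z + b.
Let w z := cexp (p + q * z + r * z ^+ 2).

Definition wexp (z : R[i]) : R :=
  Re (p + q * z + r * z ^+ 2) + (cabs (a * z + b) ^+ 2 - cabs z ^+ 2) / 2.

(** The number l for which h -> Re(l h) is the real differential of [wexp] at z; the conjugates come
    from the two squared moduli. *)
Definition wexp_slope (z : R[i]) : R[i] := q + 2 * r * z + a * (a * z + b)^* - z^*.

Lemma wexp_expand z h : wexp (z + h) = wexp z + qexp a r (wexp_slope z) h.
Proof.
rewrite /wexp /qexp /wexp_slope !sqr_cabs !expr2.
case: a b p q r z h => [a1 a2] [b1 b2] [p1 p2] [q1 q2] [r1 r2] [z1 z2] [h1 h2] /=.
by field.
Qed.

Lemma fock_weight_wcomp f z :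
  fock_weight (wcomp w phi f) z = expR (wexp z) * fock_weight f (phi z).
Proof.
rewrite /fock_weight /wcomp cabsM cabs_cexp [LHS]mulrAC -expRD.
rewrite [RHS]mulrCA -expRD [RHS]mulrC; congr (expR _ * _).
by rewrite /wexp /phi; field.
Qed.

Hypothesis a_neq1 : a != 1.

Let z0 := b / (1 - a).
Let c := Re p + Re (q * b / (1 - a)) + Re (r * b ^+ 2 / (1 - a) ^+ 2).
Let L := wexp_slope z0.

Let phi_z0 h : phi (z0 + h) = z0 + a * h.
Proof. by rewrite /phi /z0; field; rewrite subr_eq0 eq_sym. Qed.

Let wexp_z0 : wexp z0 = c.
Proof.
have E : a * z0 + b = z0 by have := phi_z0 0; rewrite /phi mulr0 !addr0.
rewrite /wexp E subrr mul0r addr0 /c !ReD; congr (_ + Re _ + Re _).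
  by rewrite /z0 mulrA.
by rewrite /z0 exprMn exprVn mulrA.
Qed.

Lemma fock_weight_iter n f h : fock_weight (iter n (wcomp w phi) f) (z0 + h) =
  expR (n%:R * c + qexp_sum a r L n h) * fock_weight f (z0 + a ^+ n * h).
Proof.
elim: n h => [|n IH] h; first by rewrite mul0r add0r /qexp_sum big_ord0 expR0 !mul1r.
rewrite iterS fock_weight_wcomp phi_z0 IH mulrA -expRD; congr (expR _ * fock_weight f (z0 + _)).
  rewrite wexp_expand wexp_z0 -/L /qexp_sum big_ord_recl /= expr0 mul1r mulrS mulrDl mul1r.
  rewrite (eq_bigr (fun i : 'I_n => qexp a r L (a ^+ lift ord0 i * h))); first by ring.
  by move=> i _; rewrite mulrA -exprSr.
by rewrite mulrA -exprSr.
Qed.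

Let half_line_box (k x : R) : exists y, forall t, y <= t <= y + 1 -> 0 <= k * (t - x) /\ `|t - x| <= 1.
Proof.
have [k0|k0] := leP 0 k; [exists x|exists (x - 1)] => t /andP[t1 t2]; split.
- by rewrite mulr_ge0// subr_ge0.
- by rewrite ler_norml; apply/andP; split; lra.
- by rewrite nmulr_rge0//; lra.
- by rewrite ler_norml; apply/andP; split; lra.
Qed.

(* Testing the operator on the kernel at phi z, and bounding its norm from below
   on a unit box with corner z where the linear term is nonnegative. *)
Lemma wexp_bounded (nu : R) : 0 < nu -> cabs a <= 1 -> bounded_on_fock nu (wcomp w phi) ->
  exists C, forall z, wexp z <= C.
Proof.
move=> nu0 a1 [stable [K HK]].
(* Bounds the loss on the box, where |h|^2 <= 2: at most 2 |r| from Re(r h^2), and at most 2 from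
   the remaining quadratic term and the Gaussian of the kernel together. *)
set M := 2 * cabs r + 2.
set k := (nu / (2 * pi)) `^ nu^-1.
have k0 : 0 < k by rewrite powR_gt0// divr_gt0// mulr_gt0// pi_gt0.
exists (ln (K / k * expR M)) => z.
set u := phi z.
have hK := in_fock_exp_kernel u nu0.
have hT := stable _ hK.
set l := wexp_slope z.
have [x0 Hx] := half_line_box (Re l) (Re z); have [y0 Hy] := half_line_box (- Im l) (Im z).
have lb x y : x0 <= x <= x0 + 1 -> y0 <= y <= y0 + 1 ->
    expR (cabs u ^+ 2 / 2) * expR (wexp z - M) <= fock_weight (wcomp w phi (exp_kernel u)) (x +i* y).
  move=> /Hx[x1 x2] /Hy[y1 y2].
  set h : R[i] := (x - Re z) +i* (y - Im z).
  have E : x +i* y = z + h by apply: complex_ext; rewrite ?ReD ?ImD /h /=; ring.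
  rewrite fock_weight_wcomp fock_weight_exp_kernel mulrCA ler_wpM2l ?expR_ge0//.
  rewrite -expRD ler_expR E wexp_expand -/l.
  have -> : phi (z + h) - u = a * h by rewrite /u /phi; ring.
  rewrite cabsM exprMn.
  have sq (t : R) : `|t| <= 1 -> t ^+ 2 <= 1.
    by move=> t1; rewrite -real_normK ?num_real// exprn_ile1.
  have h2 : cabs h ^+ 2 <= 2 by rewrite sqr_cabs /h /=; have := sq _ x2; have := sq _ y2; lra.
  have h0 := sqr_ge0 (cabs h).
  have a2 : cabs a ^+ 2 <= 1 by rewrite exprn_ile1 ?cabs_ge0.
  have ah0 : cabs a ^+ 2 * cabs h ^+ 2 <= cabs h ^+ 2 by rewrite ler_piMl.
  have ah1 : 0 <= cabs a ^+ 2 * cabs h ^+ 2 by rewrite mulr_ge0 ?sqr_ge0.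
  have lin : 0 <= Re (l * h) by rewrite ReM /h /= -mulNr addr_ge0.
  have rh : - (cabs r * cabs h ^+ 2) <= Re (r * h ^+ 2).
    have := normr_Re_le (r * h ^+ 2); rewrite cabsM cabsX ler_norml => /andP[+ _]; exact.
  have rh2 : cabs r * cabs h ^+ 2 <= cabs r * 2 by rewrite ler_wpM2l ?cabs_ge0.
  rewrite /qexp /M; lra.
have := fock_norm_ge nu0 hT (mulr_ge0 (expR_ge0 _) (expR_ge0 _)) lb.
move=> /le_trans /(_ (HK _ hK)); rewrite fock_norm_exp_kernel// -/k mulrCA [K * _]mulrC.
rewrite ler_pM2l ?expR_gt0// => H.
have H' : expR (wexp z) <= K / k * expR M.
  rewrite mulrAC ler_pdivlMr// -ler_pdivrMr ?expR_gt0// -expRN mulrAC -expRD mulrC//.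
rewrite -ler_expR lnK// posrE; apply: lt_le_trans H'; exact: expR_gt0.
Qed.

Hypotheses (a_gt0 : 0 < cabs a) (a_lt1 : cabs a < 1).

(** The test function is the kernel at 0, the constant 1, of norm 1. *)
Lemma not_power_bounded_of_gt0 (nu : R) : 0 < nu -> 0 < c -> ~ power_bounded_on_fock nu (wcomp w phi).
Proof.
move=> nu0 c0 [M HM]; have [ha0 ha1] := (a_gt0, a_lt1).
set k := (nu / (2 * pi)) `^ nu^-1.
have k0 : 0 < k by rewrite powR_gt0// divr_gt0// mulr_gt0// pi_gt0.
have hK := in_fock_exp_kernel (0 : R[i]) nu0.
(* [D] bounds the orbit sums for |h| <= 2 by a geometric series; [B] adds the Gaussian loss at z0 +
   a^n h, a point of modulus at most |z0| + 2. *)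
pose D := (cabs L + (cabs r + 1) * 2) * 2 / (1 - cabs a).
pose B := D + (cabs z0 + 2) ^+ 2 / 2.
have lb n x y : Re z0 <= x <= Re z0 + 1 -> Im z0 <= y <= Im z0 + 1 ->
    expR (n%:R * c - B) <= fock_weight (iter n (wcomp w phi) (exp_kernel 0)) (x +i* y).
  move=> /andP[x1 x2] /andP[y1 y2].
  set h : R[i] := (x - Re z0) +i* (y - Im z0).
  have -> : x +i* y = z0 + h by apply: complex_ext; rewrite ?ReD ?ImD /h /=; ring.
  have h2 : cabs h <= 2.
    apply: le_trans (cabs_le_ReIm _) _; rewrite /h /= !ger0_norm; lra.
  have an1 j : cabs a ^+ j <= 1 by rewrite exprn_ile1 ?cabs_ge0// ltW.
  rewrite fock_weight_iter fock_weight_exp_kernel cabs0 expr0n mul0r expR0 mul1r subr0.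
  rewrite -expRD ler_expR.
  have sumD : - D <= qexp_sum a r L n h.
    suff : `|qexp_sum a r L n h| <= D by rewrite ler_norml => /andP[].
    apply: le_trans (ler_norm_sum _ _ _) _.
    apply: (@le_trans _ _ (\sum_(j < n) (cabs L + (cabs r + 1) * 2) * 2 * cabs a ^+ j)).
      apply: ler_sum => j _; apply: le_trans (qexp_abs_le _ _ _ (ltW ha1)) _.
      have ah : cabs (a ^+ j * h) <= 2 * cabs a ^+ j.
        by rewrite cabsM cabsX mulrC ler_wpM2r ?exprn_ge0 ?cabs_ge0.
      have ah2 : cabs (a ^+ j * h) <= 2 by apply: le_trans ah _; rewrite ler_piMr.
      rewrite -[leRHS]mulrA ler_pM ?cabs_ge0 ?addr_ge0 ?mulr_ge0 ?addr_ge0 ?cabs_ge0//.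
      by rewrite lerD2l ler_wpM2l// addr_ge0 ?cabs_ge0.
    rewrite -mulr_sumr /D ler_wpM2l ?sum_geometric_le ?cabs_ge0//.
    by rewrite mulr_ge0 ?addr_ge0 ?mulr_ge0 ?addr_ge0 ?cabs_ge0.
  have zn : cabs (z0 + a ^+ n * h) ^+ 2 <= (cabs z0 + 2) ^+ 2.
    rewrite lerXn2r ?nnegrE ?addr_ge0 ?cabs_ge0//.
    apply: le_trans (ler_cabsD _ _) _; rewrite lerD2l cabsM cabsX.
    by apply: le_trans h2; rewrite ler_piMl ?cabs_ge0.
  rewrite /B; lra.
have main n : (0 < n)%N -> k * expR (n%:R * c - B) <= M.
  move=> n0; have [hn] := HM n n0 _ hK.
  rewrite fock_norm_exp_kernel// cabs0 expr0n mul0r expR0 mulr1; apply: le_trans.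
  exact: (fock_norm_ge nu0 hn (expR_ge0 _) (lb n)).
(* Chosen so that N c > |M| / k + B; then 1 + x <= expR x already gives k expR(N c - B) > |M|. *)
pose N := (Num.bound ((`|M| / k + B) / c)).+1.
have := main N isT; apply/negP; rewrite -ltNge.
apply: (le_lt_trans (ler_norm M)).
rewrite mulrC -ltr_pdivrMr//; apply: lt_le_trans (expR_ge1Dx _).
have B0 : 0 <= B.
  have t0 : 0 <= (cabs L + (cabs r + 1) * 2) * 2.
    by rewrite mulr_ge0// addr_ge0 ?cabs_ge0// mulr_ge0// addr_ge0 ?cabs_ge0.
  by rewrite addr_ge0 ?divr_ge0 ?sqr_ge0 ?subr_ge0 ?(ltW ha1).
have : (`|M| / k + B) / c < N%:R.
  apply: lt_trans (archi_boundP _) _; last by rewrite ltr_nat.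
  by rewrite divr_ge0 ?(ltW c0)// addr_ge0// divr_ge0 ?(ltW k0).
rewrite ltr_pdivrMr//; lra.
Qed.

Lemma power_bounded_of_lt (nu : R) : 1 <= nu -> 0 < cabs r -> cabs r <= (1 - cabs a ^+ 2) / 2 ->
  bounded_on_fock nu (wcomp w phi) -> c - ln (cabs a) < 0 ->
  power_bounded_on_fock nu (wcomp w phi).
Proof.
move=> nu1 r0 ra bd ca; have [ha0 ha1] := (a_gt0, a_lt1).
have nu0 : 0 < nu by apply: lt_le_trans nu1.
have [T0 HT0] := wexp_bounded nu0 (ltW ha1) bd.
have [|C HC] := @qexp_sum_le R a r L ha1 r0 ra.
  (* The slope at the fixed point is [L] and the value there is c, so a bound on [wexp] is a bound
     on S shifted by c. *)
  exists (T0 - c) => h; have := HT0 (z0 + h); rewrite wexp_expand wexp_z0 -/L; lra.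
have c12 : Im (sqrtc r) != 0 \/ Re (sqrtc r) != 0.
  have [i0|] := eqVneq (Im (sqrtc r)) 0; [right|by left].
  apply/eqP => re0; have : sqrtc r = 0 by apply: complex_ext.
  by move/eqP; rewrite sqrtc_eq0 -cabs_eq0 gt_eqF.
(* The ridge has strength [nu] because the pointwise bound containing -eta^2 is raised to the power
   [nu]. *)
have [K K0 HE] := fock_comp_estimate nu1 nu0 c12.
pose M := expR (C * nu) * K.
have M0 : 0 <= M by rewrite mulr_ge0 ?expR_ge0// ltW.
have stable n f : in_fock nu f -> in_fock nu (iter n (wcomp w phi) f).
  by move=> hf; elim: n => [|n IH]; [exact: hf|exact: (bd.1 _ IH)].
exists (M `^ nu^-1) => n n0 f hf; have hn := stable n f hf; split; first exact: hn.
apply: (fock_norm_le nu0 M0 hf hn).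
have an0 : a ^+ n != 0 by rewrite expf_neq0// -cabs_gt0.
have df := entire_cdiff hf.1.
(* al z + be = z0 + a^n (z - z0) is the n-th iterate of [phi]. *)
pose al := a ^+ n; pose be := z0 - a ^+ n * z0.
pose E (xy : R * R) := expR (- (nu * (Im (sqrtc r) * (xy.1 - Re z0) + Re (sqrtc r) * (xy.2 - Im z0)) ^+ 2)).
pose k := expR ((n%:R * c + C) * nu).
have mE : measurable_fun setT E.
  apply: measurableT_comp => //; apply: measurableT_comp => //; apply: measurable_funM => //.
  apply: measurable_funX; apply: measurable_funD => //; apply: measurable_funM => //;
  exact: measurable_funB.
have mW := measurable_funM mE (measurable_fock_weight_affine nu al be df).
have W0 xy : 0 <= E xy * fock_weight f (al * plane xy + be) `^ nu.
  by rewrite mulr_ge0 ?expR_ge0 ?powR_ge0.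
have le1 xy : fock_weight (iter n (wcomp w phi) f) (plane xy) `^ nu <=
    k * (E xy * fock_weight f (al * plane xy + be) `^ nu).
  pose h := plane xy - z0.
  have -> : plane xy = z0 + h by rewrite /h addrC subrK.
  rewrite fock_weight_iter powRM ?expR_ge0 ?fock_weight_ge0// -expRM.
  have -> : al * (z0 + h) + be = z0 + a ^+ n * h by rewrite /al /be; ring.
  rewrite mulrA ler_wpM2r ?powR_ge0// -expRD ler_expR.
  have := HC n h n0.
  have -> : Re h = xy.1 - Re z0 by rewrite /h ReD ReN.
  have -> : Im h = xy.2 - Im z0 by rewrite /h ImD ImN.
  set Q := (_ + _) ^+ 2 => HQ; set q0 := qexp_sum _ _ _ _ _ in HQ *.
  have -> : (n%:R * c + C) * nu + - (nu * Q) = (n%:R * c + (C - Q)) * nu by ring.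
  by rewrite ler_pM2r// lerD2l.
have an_gt0 : 0 < cabs a ^+ n by rewrite exprn_gt0.
have kle : k * (K / cabs al) <= M.
  rewrite /al cabsX /M /k mulrDl expRD.
  suff H : expR (n%:R * c * nu) <= cabs a ^+ n.
    rewrite (_ : _ * _ = expR (C * nu) * K * (expR (n%:R * c * nu) / cabs a ^+ n)); last by ring.
    by rewrite ler_piMr// ler_pdivrMr// mul1r.
  have la0 : ln (cabs a) <= 0 by rewrite ln_le0// ltW.
  (* Here 1 <= nu enters: c is negative, so c nu <= c < ln|a|. *)
  have cnu : c * nu <= ln (cabs a).
    have cneg : c <= 0 by lra.
    apply: (@le_trans _ _ c); last by lra.
    rewrite -subr_ge0 (_ : c - c * nu = (- c) * (nu - 1)); last by ring.
    by rewrite mulr_ge0 ?oppr_ge0 ?subr_ge0.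
  have -> : cabs a ^+ n = expR (n%:R * ln (cabs a)) by rewrite expRM_natl lnK// posrE.
  by rewrite ler_expR -mulrA ler_wpM2l.
apply: (@le_trans _ _ (k%:E * \int[mu2]_xy (E xy * fock_weight f (al * plane xy + be) `^ nu)%:E)%E).
  rewrite (@ge0_integralZl_real _ _ _ mu2 _ _ mW W0 (expR_ge0 _)) fock_integralE.
  apply: ge0_le_integral => //.
  - by move=> xy _; rewrite lee_fin powR_ge0.
  - apply/measurable_EFinP; exact: (measurable_fock_weight nu (entire_cdiff hn.1)).
  - apply/measurable_EFinP; exact: (measurable_funM (measurable_cst k) mW).
  by move=> xy _; rewrite lee_fin; exact: le1.
apply: (@le_trans _ _ (k%:E * ((K / cabs al)%:E * fock_integral nu f))%E).
  by apply: lee_wpmul2l; [rewrite lee_fin expR_ge0|exact: (HE f al be (Re z0) (Im z0) df an0)].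
rewrite muleA -EFinM; apply: lee_wpmul2r; first exact: fock_integral_ge0.
by rewrite lee_fin.
Qed.

End WeightedComposition.

Theorem theorem3p4 (R : realType) (nu : R) (a b p q r : R[i]) :
  1 <= nu ->
  0 < cabs a -> cabs a < 1 ->
  0 < cabs r -> cabs r <= (1 - cabs a ^+ 2) / 2 ->
  let phi := fun z : R[i] => a * z + b in
  let w := fun z : R[i] => cexp (p + q * z + r * z ^+ 2) in
  bounded_on_fock nu (wcomp w phi) ->
  (0 < complex.Re p + complex.Re (q * b / (1 - a))
       + complex.Re (r * b ^+ 2 / (1 - a) ^+ 2) ->
     ~ power_bounded_on_fock nu (wcomp w phi)) /\
  (complex.Re p + complex.Re (q * b / (1 - a))
       + complex.Re (r * b ^+ 2 / (1 - a) ^+ 2) - ln (cabs a) < 0 ->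
     power_bounded_on_fock nu (wcomp w phi)).
Proof.
move=> nu1 a0 a1 r0 ra phi w bd.
have an1 : a != 1 by apply: contraTneq a1 => ->; rewrite cabs1 ltxx.
split => hc.
  by apply: not_power_bounded_of_gt0 => //; apply: lt_le_trans nu1.
exact: power_bounded_of_lt.
Qed.
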